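(* Let $m\ge 5$, let $A=\{s,f,a_1,\dots,a_{m-2}\}$ be a set of size $m$, and let $\theta=(sf)\sigma$ be a permutation of $A$ such that $\sigma=(a_1\,a_{m-2})$ or $\sigma=(a_2\,a_{m-2})$. The number of maximal Arrow's single-peaked domains on $A$ with $P=(s,a_1,\dots,a_{m-2},f)$ and $Q=\theta(P)$ as extremal paths is $\mathcal{P}(m-3)$. Moreover, all such domains are self-paired.
   Context: A linear order on a finite set $A$ of size $m$ is identified with a directed Hamilton path through $A$, i.e. a sequence $(b_1,\dots,b_m)$ listing every element of $A$ exactly once (most preferred first). A set $D$ of linear orders on $A$ is a Condorcet domain if there are no three orders in $D$ and distinct $b_1,b_2,b_3\in A$ such that the three orders rank these elements as $b_1\succ b_2\succ b_3$, $b_2\succ b_3\succ b_1$, $b_3\succ b_1\succ b_2$ respectively. It is maximal if it is not properly contained in another Condorcet domain on $A$. An Arrow's single-peaked domain is a Condorcet domain $D$ such that every triple (3-element subset) $T\subseteq A$ has a ''never-bottom'' element, i.e. an element of $T$ which no order of $D$ ranks last among the elements of $T$. A maximal Arrow's single-peaked domain is an Arrow's single-peaked domain which is maximal as a Condorcet domain. A terminal element of $D$ is an element which is last in some order of $D$; a maximal Arrow's single-peaked domain has exactly two terminal elements. A path in $D$ is extremal if it starts at one terminal element and ends at the other; such a $D$ has exactly two extremal paths. Permutations (written in cycle notation) act on paths entrywise. If $P$ and $Q=\theta(P)$ are the extremal paths of $D$, then $\theta$ is called the inherited permutation of $D$, and $D$ is self-paired if $\{\theta(W):W\in D\}=D$.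 $\mathcal{P}(n)$ denotes the total number of maximal Arrow's single-peaked domains on a set of size $n$ (counted as sets of orders, without reduction under isomorphism) which all share a common fixed extremal path. *)

(* Defs.v *)
From HB Require Import structures.
From mathcomp Require Import all_boot all_fingroup.

Set Implicit Arguments.
Unset Strict Implicit.
Unset Printing Implicit Defensive.

(* A duplicate-free sequence of length #|A| lists every element of A exactly
   once; the head of the sequence is the most preferred element. *)
Record linorder (A : finType) := LinOrder {
  lo_tuple :> #|A|.-tuple A;
  lo_uniq : uniq lo_tuple
}.

HB.instance Definition _ (A : finType) := [isSub for @lo_tuple A].
HB.instance Definition _ (A : finType) := [Finite of linorder A by <:].

Section Domains.

Variable A : finType.
Implicit Types (w u v P Q : linorder A) (D : {set linorder A}).
Implicit Types (T : {set A}) (x y b : A) (theta : {perm A}).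

Definition prefers w x y : bool := index x w < index y w.

Definition ranks3 w b1 b2 b3 : bool := prefers w b1 b2 && prefers w b2 b3.

Definition condorcet D : bool :=
  ~~ [exists u in D, exists v in D, exists w in D,
      exists b1 : A, exists b2 : A, exists b3 : A,
        [&& uniq [:: b1; b2; b3],
            ranks3 u b1 b2 b3, ranks3 v b2 b3 b1 & ranks3 w b3 b1 b2]].

Definition ranks_last w T x : bool :=
  (x \in T) && [forall y in T, (y != x) ==> prefers w y x].

Definition never_bottom D T x : bool :=
  (x \in T) && [forall w in D, ~~ ranks_last w T x].

Definition arrow_sp D : bool :=
  condorcet D && [forall T : {set A}, (#|T| == 3) ==> [exists x : A, never_bottom D T x]].

Definition max_arrow_sp D : bool := arrow_sp D && maxset condorcet D.

(* For x : A the sequence w is nonempty, so the default value x of head and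
   last is not used: head x w == x says that w starts at x, and last x w == x
   that it ends at x. *)
Definition terminals D : {set A} := [set x | [exists w in D, last x w == x]].

Definition extremal_paths D : {set linorder A} :=
  [set w in D | [exists x : A, exists y : A,
     [&& x != y, terminals D == [set x; y], head x w == x & last y w == y]]].

Lemma perm_path_subproof theta w : uniq (map_tuple theta w).
Proof. by rewrite (map_inj_uniq perm_inj) lo_uniq. Qed.

Definition perm_path theta w : linorder A :=
  LinOrder (perm_path_subproof theta w).

Definition inherited D theta : bool :=
  [exists P : linorder A, exists Q : linorder A,
     [&& P != Q, extremal_paths D == [set P; Q] & Q == perm_path theta P]].

(* The roles of P and Q may be exchanged, so a domain with two extremal paths
   has as inherited permutations some theta and its inverse; both give the same
   condition, since an injective action of theta fixes D iff that of its
   inverse does. *)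
Definition self_paired D : bool :=
  [exists theta : {perm A}, inherited D theta && ([set perm_path theta w | w in D] == D)].

Definition domains_with_extremal_paths P Q : {set {set linorder A}} :=
  [set D | max_arrow_sp D && (extremal_paths D == [set P; Q])].

Definition domains_sharing P : {set {set linorder A}} :=
  [set D | max_arrow_sp D && (P \in extremal_paths D)].

Definition enum_linorder : linorder A :=
  @LinOrder A (enum_tuple A) (enum_uniq A).

End Domains.

(* Relabelling shows that the number does not depend on the ground set of size
   n or on the shared path, so we take 'I_n and the path (0, 1, ..., n - 1). *)
Definition calP (n : nat) : nat := #|domains_sharing (enum_linorder 'I_n)|.

(* Main.v *)
Require Import Defs.
From mathcomp Require Import all_boot all_fingroup.
From mathcomp Require Import zify.

Set Implicit Arguments.
Unset Strict Implicit.
Unset Printing Implicit Defensive.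

(** Call x between u and v, in a domain D, if x is never ranked last among u, x
    and v by an order of D.  An Arrow's single-peaked domain has a between
    element in every triple, and the proof translates maximal domains into
    betweenness relations and then counts these.

    Translation (max_arrow_spP).  Say that an element e of T is extreme in T if
    it is between no two other elements of T; only an extreme element of T can
    be ranked last among T.  There are at most two extreme elements, since a
    third would leave a triple without a between element.  If every T with at
    least two elements has exactly two, then an order respecting the
    betweenness is built from the bottom by removing one of two extreme
    elements at each step, so nothing ever gets stuck: every triple is ordered
    in all four allowed ways, and any further order would close a Condorcet
    cycle.  Hence such relations, here called convexities, give maximal domains.
    Conversely every Arrow's single-peaked domain respects some convexity
    (triples_sp_convexity, by induction on the ground set), so a maximal one
    consists of all orders respecting it, and determines it
    (never_last_obeying).

    Extremal paths.  In this language a path of the domain is extremal iff it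
    starts at one of the two extreme elements of the whole set; there is one
    such path for each of them (extreme_head_inj).  So the domains with
    extremal paths P and Q correspond to the convexities that P and Q both
    respect (domains_with_compatible).

    Counting.  Write y for the last of the a_i and z for the element exchanged
    with it by sigma.  If P and Q rank different elements of a triple last, the
    third element must be the between one.  The key fact
    (common_last_fixed) is that P and Q agree on the last element of a triple
    only if theta fixes all three elements.  So a convexity respected by P and
    Q is determined by its restriction to C, the ground set without s, f and y,
    and it is invariant under theta; this invariance is self-pairedness.  On C,
    z is extreme because Q ranks it last, and the path that starts at z and
    continues like P respects the convexity.  Conversely a convexity on C with
    these two properties extends to the ground set by making between, in each
    triple outside C, the element that neither P nor Q ranks last
    (lift_compatible): the bottoms of P and of Q provide the two extreme
    elements.  As C has m - 3 elements, there are as many such convexities as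
    maximal domains on m - 3 elements sharing a fixed extremal path. *)

(** * Linear orders as rankings *)

Section LinearOrders.
Variable A : finType.
Implicit Types (w u v : linorder A) (x y z : A) (t : seq A).

Lemma mem_lo w x : x \in tval w.
Proof.
have /card_uniqP E := lo_uniq w.
by rewrite (subset_cardP _ (subset_predT _)) // E size_tuple.
Qed.

Lemma index_lo_inj w : injective (fun x => index x w).
Proof. by move=> x y /= e; rewrite -(nth_index x (mem_lo w x)) e nth_index ?mem_lo. Qed.

Lemma index_lo_lt w x : index x w < #|A|.
Proof. by rewrite -[X in _ < X](size_tuple w) index_mem mem_lo. Qed.

Lemma prefers_asym w x y : prefers w x y -> ~~ prefers w y x.
Proof. by rewrite /prefers; lia. Qed.

Lemma prefers_trans w y x z : prefers w x y -> prefers w y z -> prefers w x z.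
Proof. by rewrite /prefers; lia. Qed.

Lemma prefers_neq w x y : prefers w x y -> x != y.
Proof. by apply: contraTneq => ->; rewrite /prefers; lia. Qed.

Lemma prefers_total w x y : x != y -> ~~ prefers w x y -> prefers w y x.
Proof.
rewrite /prefers -leqNgt leq_eqVlt => /eqP ne /orP[/eqP e|//].
by case: ne; apply: (@index_lo_inj w).
Qed.

Lemma last_lo w x : (last x w == x) = (index x w == #|A|.-1).
Proof.
have last_seq t : uniq t -> x \in t -> (last x t == x) = (index x t == (size t).-1).
  case: t => [|y t] // Ut xt; rewrite [(size _).-1]/= -(index_last Ut).
  apply/eqP/eqP => [e|]; first by rewrite -[in LHS]e.
  by move/(index_inj x xt (mem_last y t)).
by rewrite last_seq ?lo_uniq ?mem_lo // size_tuple.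
Qed.

Lemma head_lo w x : (head x w == x) = (index x w == 0).
Proof. by have := mem_lo w x; case: (tval w) => [|y t] //= _; case: eqP. Qed.

Lemma last_loP w x :
  reflect (forall y, y != x -> prefers w y x) (last x w == x).
Proof.
rewrite last_lo; apply: (iffP eqP) => [e y ne | H].
  have := index_lo_lt w y; have := inj_eq (@index_lo_inj w) y x.
  by rewrite (negPf ne) /prefers e; lia.
apply/eqP; rewrite eqn_leq -ltnS prednK ?index_lo_lt; last first.
  exact: leq_trans (index_lo_lt w x).
rewrite leqNgt; apply/negP => lt.
have sz : (index x w).+1 < size w by rewrite size_tuple; lia.
have /H : nth x w (index x w).+1 != x.
  by rewrite -(inj_eq (@index_lo_inj w)) index_uniq ?lo_uniq //; lia.
by rewrite /prefers index_uniq ?lo_uniq //; lia.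
Qed.

Lemma head_lo_prefers w x y : head x w == x -> y != x -> prefers w x y.
Proof.
rewrite head_lo /prefers -(inj_eq (@index_lo_inj w)); lia.
Qed.

Lemma lo_ext w v : (forall x y, prefers w x y -> prefers v x y) -> w = v.
Proof.
move=> H; do 2 apply: val_inj => /=.
apply: (@sorted_eq _ (fun x y => index x v <= index y v)).
- by move=> y x z; apply: leq_trans.
- by move=> x y; rewrite -eqn_leq => /eqP; apply: index_lo_inj.
- case e: (tval w) => [|x0 t] //; rewrite -e.
  apply/(sortedP x0) => i lt; apply: ltnW; apply: H.
  by rewrite /prefers !index_uniq ?lo_uniq ?(ltnW lt).
- case e: (tval v) => [|x0 t] //; rewrite -e.
  by apply/(sortedP x0) => i lt; rewrite !index_uniq ?lo_uniq ?(ltnW lt).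
by apply: uniq_perm (lo_uniq w) (lo_uniq v) _ => x; rewrite !mem_lo.
Qed.

(** Orders on a subset are handled as sequences; this realizes one as the top
    part of a linear order on the whole type. *)
Lemma complete_lo t : uniq t ->
  exists w, (forall x, x \in t -> index x w = index x t) /\
            (forall x y, x \in t -> y \notin t -> prefers w x y).
Proof.
move=> Ut; pose r := [seq x <- enum A | x \notin t].
have Utr : uniq (t ++ r).
  rewrite cat_uniq Ut filter_uniq ?enum_uniq // andbT /=.
  by apply/hasPn => x; rewrite mem_filter => /andP[].
have szr : size (t ++ r) == #|A|.
  rewrite cardE; apply/eqP/perm_size/uniq_perm; rewrite ?enum_uniq // => x.
  by rewrite mem_cat mem_filter mem_enum andbT; case: (x \in t).
exists (@LinOrder A (Tuple szr) Utr).
split=> [x xt | x y xt yt]; rewrite /prefers /= !index_cat xt // (negPf yt).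
by have := xt; rewrite -index_mem; lia.
Qed.

End LinearOrders.

(** * Convexities and the orders respecting them *)

Section Betweenness.
Variable A : finType.
Implicit Types (B : A -> A -> A -> bool) (S T : {set A}) (D : {set linorder A}).

(** [B u x v] reads: x lies between u and v.  Only values at three distinct
    elements are meaningful. *)
Definition extreme B S e :=
  e \in S /\ forall u v, u \in S -> v \in S ->
    u != e -> v != e -> u != v -> ~~ B u e v.

(** By [between_total] no three elements are extreme, so [two_extremes] means
    exactly two.  It is imposed on all subsets, which makes the notion inherited
    by them and so suited to removing elements one by one. *)
Record convexity S B := Convexity {
  between_sym : forall u x v, B u x v = B v x u;
  between_total : forall x y z, x \in S -> y \in S -> z \in S ->
    x != y -> y != z -> x != z -> [|| B y x z, B x y z | B x z y];
  two_extremes : forall T, T \subset S ->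
    forall x y, x \in T -> y \in T -> x != y ->
    exists e1 e2, [/\ e1 != e2, extreme B T e1 & extreme B T e2] }.

(** Only the relative order of the elements of [S] in [t] matters, so that one
    linear order on the whole type can be tested against a relation on [S]. *)
Definition obeys S B (t : seq A) := forall u x v,
  u \in S -> x \in S -> v \in S -> u != v ->
  index u t < index x t -> index v t < index x t -> ~~ B u x v.

Definition obeying S B : {set linorder A} :=
  [set w | [forall u in S, forall x in S, forall v in S,
     [&& u != v, prefers w u x & prefers w v x] ==> ~~ B u x v]].

Lemma obeyingP S B (w : linorder A) : reflect (obeys S B w) (w \in obeying S B).
Proof.
rewrite inE; apply: (iffP forallP) => [H u x v uS xS vS uv lu lv | H u].
  have /implyP/(_ uS)/forallP/(_ x)/implyP/(_ xS)/forallP/(_ v) := H u.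
  by move=> /implyP/(_ vS)/implyP; apply; apply/and3P.
apply/implyP => uS; apply/forallP => x; apply/implyP => xS; apply/forallP => v.
by apply/implyP => vS; apply/implyP => /and3P[uv lu lv]; apply: H.
Qed.

Lemma convexityS S T B : T \subset S -> convexity S B -> convexity T B.
Proof.
move=> /subsetP sTS [sy to ex]; split=> // [x y z /sTS xS /sTS yS /sTS zS|].
  exact: to.
by move=> U sUT; apply: ex; apply: subset_trans sUT (introT subsetP sTS).
Qed.

Lemma extreme_pair B S x y e :
  S \subset [set x; y] -> e \in S -> extreme B S e.
Proof.
move=> /subsetP sub eS; split=> // u v uS vS ue ve uv.
have := sub _ eS; have := sub _ uS; have := sub _ vS.
rewrite !inE => /pred2P[] ? /pred2P[] ? /pred2P[] ?; subst;
  by rewrite ?eqxx in ue ve uv.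
Qed.

Lemma three_extremes S B x y z : convexity S B ->
  extreme B S x -> extreme B S y -> extreme B S z ->
  x != y -> y != z -> x = z.
Proof.
move=> cB [xS ex] [yS ey] [zS ez] xy yz; apply/eqP/contraT => xz.
have := between_total cB xS yS zS xy yz xz.
rewrite (negPf (ex _ _ yS zS _ _ _)) 1?eq_sym // 1?eq_sym //.
rewrite (negPf (ey _ _ xS zS _ _ _)) // 1?eq_sym //.
by rewrite (negPf (ez _ _ xS yS _ _ _)).
Qed.

(** If both x and y were between, only z could be extreme in the triple. *)
Lemma between_excl S B x y z : convexity S B ->
  x \in S -> y \in S -> z \in S -> x != y -> y != z -> x != z ->
  B y x z -> ~~ B x y z.
Proof.
move=> cB xS yS zS xy yz xz Bx; apply/negP => By.
have xT : x \in [set x; y; z] by rewrite !inE eqxx.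
have yT : y \in [set x; y; z] by rewrite !inE eqxx orbT.
have zT : z \in [set x; y; z] by rewrite !inE eqxx !orbT.
have sT : [set x; y; z] \subset S.
  by apply/subsetP => u; rewrite !inE -orbA => /or3P[]/eqP->.
have onlyz e : extreme B [set x; y; z] e -> e = z.
  case; rewrite !inE -orbA => /or3P[]/eqP-> // H.
    by move: (H y z yT zT); rewrite Bx 1?eq_sym xy eq_sym xz yz; move/(_ isT isT isT).
  by move: (H x z xT zT); rewrite By xy eq_sym yz xz; move/(_ isT isT isT).
have [e1 [e2 [ne /onlyz e1z /onlyz e2z]]] := two_extremes cB sT xT yT xy.
by rewrite e1z e2z eqxx in ne.
Qed.

Definition same_order (t u : seq A) :=
  {in t &, forall x y, index x t < index y t -> index x u < index y u}.

Lemma index_rcons_old (t : seq A) e x : x \in t -> index x (rcons t e) = index x t.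
Proof. by move=> xt; rewrite -cats1 index_cat xt. Qed.

Lemma index_rcons_new (t : seq A) e : e \notin t -> index e (rcons t e) = size t.
Proof. by move=> et; rewrite -cats1 index_cat (negPf et) /= eqxx addn0. Qed.

Lemma obeys_rcons S B e t : extreme B S e -> t =i S :\ e -> obeys (S :\ e) B t ->
  obeys S B (rcons t e).
Proof.
move=> [eS He] tS ot u x v uS xS vS uv.
have et : e \notin t by rewrite tS !inE eqxx.
have inS y : y \in S -> y != e -> y \in t by move=> yS ye; rewrite tS !inE ye.
have [-> | xe] := eqVneq x e.
  rewrite index_rcons_new // => lu lv; apply: He => //.
    by apply: contraTneq lu => ->; rewrite index_rcons_new // ltnn.
  by apply: contraTneq lv => ->; rewrite index_rcons_new // ltnn.
have xt := inS _ xS xe; have lx : index x t < size t by rewrite index_mem.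
rewrite (index_rcons_old _ xt).
have [-> | ue] := eqVneq u e; first by rewrite index_rcons_new // ltnNge (ltnW lx).
have [-> | ve] := eqVneq v e; first by rewrite (index_rcons_new et) [size t < _]ltnNge (ltnW lx).
rewrite !index_rcons_old ?inS //; apply: ot; rewrite -?tS ?inS //.
Qed.

(** The order is built from the bottom.  At each step either some extreme
    element of [S] is missing from [t], and can be put last for free, or both
    are in [t]; then the last element of [t] is one of them, for otherwise the
    three would form a triple without a between element, and it can be put last
    without disturbing [t]. *)
Lemma extend_obeying S B t : convexity S B -> uniq t -> {subset t <= S} ->
  obeys [set x in t] B t ->
  exists u, [/\ uniq u, u =i S, same_order t u & obeys S B u].
Proof.
move: {2}#|S| (erefl #|S|) => k; elim: k S t => [|k IH] S t cS cB Ut tS ot.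
  have S0 := cards0_eq cS; exists [::].
  by split=> // [x | x y /tS]; rewrite S0 in_set0.
have [e [He Het]] : exists e, extreme B S e /\
    (e \notin t \/ exists t', t = rcons t' e).
  have [/existsP[x /andP[xS /existsP[y /andP[yS xy]]]] | /existsPn no] :=
    boolP [exists x, (x \in S) && [exists y, (y \in S) && (x != y)]].
    have [e1 [e2 [ne E1 E2]]] := two_extremes cB (subxx S) xS yS xy.
    have [e1t | n1] := boolP (e1 \in t); last by exists e1; split; [|left].
    have [e2t | n2] := boolP (e2 \in t); last by exists e2; split; [|left].
    case/lastP: t => [//|t e] in Ut tS ot e1t e2t *.
    exists e; split; last by right; exists t.
    have et : e \in rcons t e by rewrite mem_rcons in_cons eqxx.
    have [-> // | ee1] := eqVneq e e1; have [-> // | ee2] := eqVneq e e2.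
    move: (Ut); rewrite rcons_uniq => /andP[net _].
    have lt1 c : c \in rcons t e -> e != c -> index c (rcons t e) < index e (rcons t e).
      rewrite mem_rcons in_cons eq_sym => /orP[-> //|xt] _.
      by rewrite index_rcons_new // index_rcons_old // index_mem.
    have := between_total cB (tS _ e1t) (tS _ et) (tS _ e2t).
    rewrite eq_sym ee1 ee2 ne => /(_ isT isT isT).
    case: E1 => e1S E1; case: E2 => e2S E2.
    have ne' : e2 != e1 by rewrite eq_sym.
    rewrite (negPf (E1 _ _ (tS _ et) e2S ee1 ne' ee2)).
    rewrite (negPf (E2 _ _ e1S (tS _ et) ne ee2 _)) 1?eq_sym // orbF /=.
    by rewrite (negPf (ot _ _ _ _ _ _ ne (lt1 _ e1t ee1) (lt1 _ e2t ee2))) ?inE.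
  have /card_gt0P[e eS] : 0 < #|S| by rewrite cS.
  have only x : x \in S -> x = e.
    move=> xS; have := no x; rewrite xS /= => /existsPn/(_ e).
    by rewrite eS negbK => /eqP.
  exists e; split.
    by apply: (@extreme_pair _ _ e e) => //; apply/subsetP => x /only->; rewrite !inE eqxx.
  have [et | et] := boolP (e \in t); [right | by left].
  case/lastP: t et Ut tS ot => [//|t x] _ _ tS _; exists t.
  by rewrite (only x) // tS // mem_rcons in_cons eqxx.
have eS := He.1.
have cS' : #|S :\ e| = k by have := cardsD1 e S; rewrite eS cS => -[].
have cB' := convexityS (subD1set S e) cB.
case: Het => [et | [t' tE]].
  have [|u [Uu uS so ou]] := IH _ t cS' cB' Ut _ ot.
    by move=> x xt; rewrite !inE tS // andbT; apply: contraNneq et => <-.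
  have eu : e \notin u by rewrite uS !inE eqxx.
  exists (rcons u e); split; first by rewrite rcons_uniq Uu eu.
  - by move=> x; rewrite mem_rcons in_cons uS !inE; case: eqP => // ->.
  - move=> x y xt yt; rewrite !index_rcons_old => [/so->//||];
      by rewrite uS !inE tS // andbT; apply: contraNneq et => <-.
  - exact: obeys_rcons.
subst t; move: (Ut); rewrite rcons_uniq => /andP[et Ut'].
have t'S : {subset t' <= S :\ e}.
  move=> x xt; rewrite !inE tS ?mem_rcons ?in_cons ?xt ?orbT // andbT.
  by apply: contraNneq et => <-.
have ot' : obeys [set x in t'] B t'.
  move=> u x v; rewrite !inE => ut xt vt uv lu lv.
  by apply: ot; rewrite ?inE ?mem_rcons ?in_cons ?ut ?xt ?vt ?orbT ?index_rcons_old.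
have [u [Uu uS so ou]] := IH _ t' cS' cB' Ut' t'S ot'.
have eu : e \notin u by rewrite uS !inE eqxx.
exists (rcons u e); split; first by rewrite rcons_uniq Uu eu.
- by move=> x; rewrite mem_rcons in_cons uS !inE; case: eqP => // ->.
- move=> x y; rewrite !mem_rcons !in_cons.
  move=> /predU1P[->|xt] /predU1P[->|yt].
  + by rewrite ltnn.
  + rewrite index_rcons_new // index_rcons_old //.
    by rewrite ltnNge ltnW // index_mem.
  + have xu : x \in u by rewrite uS t'S.
    by move=> _; rewrite (index_rcons_new eu) index_rcons_old // index_mem.
  + by rewrite !index_rcons_old ?uS ?t'S //; apply: so.
- exact: obeys_rcons.
Qed.

Lemma extend_lo S B t : convexity S B -> uniq t -> {subset t <= S} ->
  obeys [set x in t] B t ->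
  exists w : linorder A, [/\ w \in obeying S B, same_order t w
    & forall x y, x \in S -> y \notin S -> prefers w x y].
Proof.
move=> cB Ut tS ot; have [u [Uu uS so ou]] := extend_obeying cB Ut tS ot.
have [w [iw pw]] := complete_lo Uu.
exists w; split.
- apply/obeyingP => a x b aS xS bS; rewrite !iw ?uS //; exact: ou.
- by move=> x y xt yt; rewrite !iw ?uS ?tS //; apply: so.
- by move=> x y xS yS; apply: pw; rewrite uS.
Qed.

(** Every order of a triple not ending in its between element occurs: domains
    coming from convexities are copious. *)
Lemma extend_triple S B a b c : convexity S B ->
  a \in S -> b \in S -> c \in S -> a != b -> b != c -> a != c -> ~~ B a c b ->
  exists w : linorder A, [/\ w \in obeying S B, prefers w a b, prefers w b c
    & forall x y, x \in S -> y \notin S -> prefers w x y].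
Proof.
move=> cB aS bS cS ab bc ac nB.
have ia : index a [:: a; b; c] = 0 by rewrite /= eqxx.
have ib : index b [:: a; b; c] = 1 by rewrite /= (negPf ab) eqxx.
have ic : index c [:: a; b; c] = 2 by rewrite /= (negPf ac) (negPf bc) eqxx.
have [|||w [wd so out]] := @extend_lo S B [:: a; b; c] cB.
- by rewrite /= !inE negb_or ab ac bc.
- by move=> x; rewrite !inE => /or3P[]/eqP->.
- move=> u x v; rewrite !inE.
  move=> /or3P[]/eqP-> /or3P[]/eqP-> /or3P[]/eqP->; rewrite ?ia ?ib ?ic ?eqxx //.
  by rewrite (between_sym cB).
exists w; split=> //; apply: so;
  by rewrite ?ia ?ib ?ic ?inE ?eqxx ?orbT.
Qed.

Definition never_last D u x v :=
  [forall w in D, ~~ (prefers w u x && prefers w v x)].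

Lemma never_lastP D u x v :
  reflect (forall w, w \in D -> prefers w u x -> prefers w v x -> False)
          (never_last D u x v).
Proof.
apply: (iffP forall_inP) => H w wD; last by apply/negP => /andP[]; apply: H wD.
by move=> pu pv; have := H _ wD; rewrite pu pv.
Qed.

(** A domain coming from a convexity remembers it, because it is copious. *)
Lemma never_last_obeying S B u x v : convexity S B ->
  u \in S -> x \in S -> v \in S -> u != x -> v != x -> u != v ->
  never_last (obeying S B) u x v = B u x v.
Proof.
move=> cB uS xS vS ux vx uv; apply/never_lastP/idP => [H | Bx w /obeyingP ow pu pv].
  apply: contraT => nB.
  have [w [wD uv' vx' _]] := extend_triple cB uS vS xS uv vx ux nB.
  by case: (H w wD (prefers_trans uv' vx') vx').
by have := ow _ _ _ uS xS vS uv pu pv; rewrite Bx.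
Qed.

(** Arrow's single-peakedness of the restriction of [D] to [S], expressed by
    orders on the whole type. *)
Definition triples_sp S D := forall x y z, x \in S -> y \in S -> z \in S ->
  x != y -> y != z -> x != z ->
  [|| never_last D y x z, never_last D x y z | never_last D x z y].

Lemma last_in S (w : linorder A) x : x \in S ->
  exists2 e, e \in S & forall y, y \in S -> y != e -> prefers w y e.
Proof.
move=> xS; case: (@arg_maxnP _ x (mem S) (fun y => index y w) xS) => e eS He.
exists e => // y yS ye; apply: prefers_total; first by rewrite eq_sym.
by rewrite /prefers -leqNgt; apply: He.
Qed.

(** If all orders of [D] put f last, the triples containing f are constrained
    only by f not being between.  An arbitrary order [w0] respecting the
    convexity of the rest then decides them: of f, u and v, the one of u and v
    that comes first in [w0] is between.  In a set containing f, the extreme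
    elements are f and the bottom of [w0]. *)
Lemma convexity_add_bottom S D f : f \in S ->
  (forall w x, w \in D -> x \in S -> x != f -> prefers w x f) ->
  (exists B', convexity (S :\ f) B' /\ D \subset obeying (S :\ f) B') ->
  exists B, convexity S B /\ D \subset obeying S B.
Proof.
move=> fS Df [B' [cB' /subsetP DB']].
have [|||w0 [/obeyingP ow0 _ _]] := @extend_lo _ B' [::] cB' => //.
pose B u x v := if u == f then prefers w0 x v else if v == f then prefers w0 x u
  else (x != f) && B' u x v.
have S'P x : x \in S -> x != f -> x \in S :\ f by move=> *; apply/setD1P.
have BE u x v : u != f -> x != f -> v != f -> B u x v = B' u x v.
  by rewrite /B => /negPf-> -> /negPf->.
exists B; split; last first.
  apply/subsetP => w wD; apply/obeyingP => u x v uS xS vS uv pu pv.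
  have [xf | xf] := eqVneq x f.
    have nf y : prefers w y x -> y != f by move/prefers_neq; rewrite xf.
    by rewrite /B (negPf (nf _ pu)) (negPf (nf _ pv)) xf eqxx.
  have nf y : y \in S -> prefers w y x -> y != f.
    move=> yS py; apply/eqP => e; rewrite e in py.
    by have := prefers_asym py; rewrite Df.
  have uf := nf _ uS pu; have vf := nf _ vS pv.
  by have /obeyingP ow := DB' _ wD; rewrite BE //; apply: ow; rewrite ?S'P.
split.
- move=> u x v; rewrite /B.
  have [uf|_] := eqVneq u f; have [vf|_] := eqVneq v f; rewrite ?uf ?vf //.
  by rewrite (between_sym cB').
- move=> x y z xS yS zS xy yz xz; rewrite /B.
  have tot a b : a != b -> prefers w0 a b || prefers w0 b a.
    by move=> ab; have [//|/(prefers_total ab)->] := boolP (prefers w0 a b).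
  have [xf|nx] := eqVneq x f.
    by rewrite -xf !(eq_sym _ x) (negPf xy) (negPf xz) tot ?orbT.
  have [yf|ny] := eqVneq y f.
    by rewrite -yf (eq_sym z) (negPf yz) tot.
  have [zf|nz] := eqVneq z f; first by rewrite orbA tot.
  by apply: (between_total cB') => //; apply: S'P.
move=> T sT; have [fT | fT] := boolP (f \in T); last first.
  have sT' : T \subset S :\ f.
    apply/subsetP => x xT; apply: S'P; first exact: (subsetP sT).
    by apply: contraNneq fT => <-.
  have nf x : x \in T -> x != f by move=> xT; apply: contraNneq fT => <-.
  move=> x y xT yT xy.
  have [e1 [e2 [ne [e1T E1] [e2T E2]]]] := two_extremes cB' sT' xT yT xy.
  exists e1, e2; split=> //; split=> // u v uT vT *; rewrite BE ?nf //;
    [exact: E1 | exact: E2].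
move=> x y xT yT xy.
have [z zT] : exists z, z \in T :\ f.
  have [xf|xf] := eqVneq x f; [exists y | exists x]; rewrite !inE ?xf ?yT ?xT //.
  by rewrite eq_sym -xf xy.
have [e /setD1P[ef eT] He] := last_in w0 zT.
exists f, e; split; first by rewrite eq_sym.
- by split=> // u v uT vT uf vf uv; rewrite /B (negPf uf) (negPf vf) eqxx.
split=> // u v uT vT ue ve uv; rewrite /B.
have [uf|uf] := eqVneq u f.
  by apply: prefers_asym; apply: He => //; rewrite !inE vT andbT -uf eq_sym.
have [vf|vf] := eqVneq v f.
  by apply: prefers_asym; apply: He => //; rewrite !inE uT andbT.
rewrite ef /=; apply: ow0; rewrite ?S'P ?(subsetP sT) //; apply: He => //; exact/setD1P.
Qed.

(** If s and f are to be the extreme elements, every third element is between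
    them, and no other triple contains both, so convexities on the complements
    of f and of s combine.  The extreme elements of a set containing f but not s
    are those of the second relation, which is why the two need to agree only
    through an implication. *)
Lemma convexity_glue S s f B1 B2 : s \in S -> f \in S -> s != f ->
  convexity (S :\ f) B1 -> convexity (S :\ s) B2 ->
  extreme B1 (S :\ f) s -> extreme B2 (S :\ s) f ->
  (forall x y z, x \in S :\ s :\ f -> y \in S :\ s :\ f -> z \in S :\ s :\ f ->
    x != y -> y != z -> x != z -> B1 x y z -> B2 x y z) ->
  exists B, [/\ convexity S B,
    forall u x v, u != f -> x != f -> v != f -> B u x v = B1 u x v,
    forall u x v, u != s -> x != s -> v != s -> f \in [:: u; x; v] -> B u x v = B2 u x v &
    forall u x v, s \in [:: u; x; v] -> f \in [:: u; x; v] ->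
       B u x v = (x != s) && (x != f)].
Proof.
move=> sS fS sf cB1 cB2 [_ Es] [_ Ef] B12.
pose B u x v := if f \notin [:: u; x; v] then B1 u x v
  else if s \notin [:: u; x; v] then B2 u x v else (x != s) && (x != f).
have BE1 u x v : u != f -> x != f -> v != f -> B u x v = B1 u x v.
  by rewrite /B !inE ![f == _]eq_sym => /negPf-> /negPf-> /negPf->.
have BE2 u x v : u != s -> x != s -> v != s -> f \in [:: u; x; v] -> B u x v = B2 u x v.
  rewrite /B => us xs vs -> /=.
  by rewrite !inE ![s == _]eq_sym (negPf us) (negPf xs) (negPf vs).
have BE3 u x v : s \in [:: u; x; v] -> f \in [:: u; x; v] ->
    B u x v = (x != s) && (x != f).
  by rewrite /B => -> ->.
exists B; split=> //.
have S1 x : x \in S -> x != f -> x \in S :\ f by move=> *; apply/setD1P.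
have S2 x : x \in S -> x != s -> x \in S :\ s by move=> *; apply/setD1P.
split.
- move=> u x v; have mE a : a \in [:: u; x; v] = (a \in [:: v; x; u]).
    by rewrite !inE; do !case: eqP.
  by rewrite /B !mE (between_sym cB1) (between_sym cB2).
- move=> x y z xS yS zS xy yz xz.
  have mE1 a : a \in [:: y; x; z] = (a \in [:: x; y; z]).
    by rewrite !inE; do !case: eqP.
  have mE2 a : a \in [:: x; z; y] = (a \in [:: x; y; z]).
    by rewrite !inE; do !case: eqP.
  rewrite /B !mE1 !mE2.
  have [fT|fT] := boolP (f \in _); last first.
    move: fT; rewrite !inE !negb_or ![f == _]eq_sym => /and3P[xf yf zf].
    by apply: (between_total cB1); rewrite ?S1.
  have [sT|sT] := boolP (s \in _); last first.
    move: sT; rewrite !inE !negb_or ![s == _]eq_sym => /and3P[xs ys zs].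
    by apply: (between_total cB2); rewrite ?S2.
  apply: contraT; rewrite !negb_or !negb_and !negbK.
  by move=> /and3P[/orP[]/eqP xe /orP[]/eqP ye /orP[]/eqP ze];
    move: xy yz xz; rewrite xe ye ze eqxx.
move=> T /subsetP sT x y xT yT xy.
have [fT | fT] := boolP (f \in T); last first.
  have nf a : a \in T -> a != f by move=> aT; apply: contraNneq fT => <-.
  have sT' : T \subset S :\ f by apply/subsetP => a aT; rewrite S1 ?sT ?nf.
  have [e1 [e2 [ne [e1T E1] [e2T E2]]]] := two_extremes cB1 sT' xT yT xy.
  exists e1, e2; split=> //; split=> // u v uT vT *; rewrite BE1 ?nf //;
    [exact: E1 | exact: E2].
have [sT1 | sT1] := boolP (s \in T); last first.
  have ns a : a \in T -> a != s by move=> aT; apply: contraNneq sT1 => <-.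
  have sT' : T \subset S :\ s by apply/subsetP => a aT; rewrite S2 ?sT ?ns.
  have [e1 [e2 [ne E1 E2]]] := two_extremes cB2 sT' xT yT xy.
  have lift e : extreme B2 T e -> extreme B T e.
    case=> eT E; split=> // u v uT vT ue ve uv.
    have [fx|fx] := boolP (f \in [:: u; e; v]).
      by rewrite BE2 ?ns //; apply: E.
    move: (fx); rewrite !inE !negb_or ![f == _]eq_sym => /and3P[uf ef vf].
    rewrite BE1 //; apply: contra (E _ _ uT vT ue ve uv); apply: B12 => //;
      rewrite ?in_setD1 ?uf ?ef ?vf ?ns ?sT // eq_sym //.
  by exists e1, e2; split=> //; apply: lift.
exists s, f; split=> //; split=> // u v uT vT.
  move=> us vs uv.
  have [uf|uf] := eqVneq u f; first by rewrite BE3 ?eqxx // !inE ?uf ?eqxx ?orbT.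
  have [vf|vf] := eqVneq v f; first by rewrite BE3 ?eqxx // !inE ?vf ?eqxx ?orbT.
  by rewrite BE1 //; apply: Es; rewrite // S1 ?sT.
move=> uf vf uv.
have [us|us] := eqVneq u s; first by rewrite BE3 ?eqxx ?andbF // !inE ?us ?eqxx ?orbT.
have [vs|vs] := eqVneq v s; first by rewrite BE3 ?eqxx ?andbF // !inE ?vs ?eqxx ?orbT.
rewrite BE2 // 1?eq_sym // ?inE ?eqxx ?orbT //; apply: Ef; rewrite // S2 ?sT //.
Qed.

End Betweenness.

(** * Every Arrow's single-peaked domain respects a convexity *)

Section Structure.
Variable A : finType.
Implicit Types (B : A -> A -> A -> bool) (S T : {set A}) (D : {set linorder A}).

Lemma never_lastS D D' u x v : D \subset D' ->
  never_last D' u x v -> never_last D u x v.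
Proof.
move=> /subsetP sDD' /never_lastP H; apply/never_lastP => w /sDD' wD; exact: H.
Qed.

Lemma triples_spS S T D : T \subset S -> triples_sp S D -> triples_sp T D.
Proof. by move=> /subsetP sTS H x y z /sTS xS /sTS yS /sTS zS; apply: H. Qed.

Lemma last_not_never D w e u v : w \in D -> prefers w u e -> prefers w v e ->
  ~~ never_last D u e v.
Proof. by move=> wD pu pv; apply/negP => /never_lastP/(_ w wD pu pv). Qed.

(** Induction on the size of [S].  If [D] has a common bottom f, remove it.
    Otherwise let s and f be bottoms of two orders of [D]; a third bottom would
    form with them a triple without a never-bottom element.  Let [B1] be a
    convexity for the complement of f.  Adding to [D] all orders that respect
    [B1] and end in f creates no new bottom: inside the complement of f these
    orders respect [B1], and in a triple containing f they rank f last, which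
    the order with bottom f does already.  A convexity [B2] for the complement
    of s, respected by the enlarged domain [D1], must then agree with [B1]
    away from s and f, because [D1] is copious there; so the two glue. *)
Theorem triples_sp_convexity S D : triples_sp S D ->
  exists B, convexity S B /\ D \subset obeying S B.
Proof.
move: {2}#|S| (erefl #|S|) => k; elim: k S D => [|k IH] S D cS tri.
  have S0 := cards0_eq cS; exists (fun _ _ _ => true); split.
    split=> // [T sT x y xT]; move: sT; rewrite S0 subset0 => /eqP T0.
    by rewrite T0 in_set0 in xT.
  by apply/subsetP => w _; apply/obeyingP => u x v; rewrite S0 in_set0.
have cS1 e : e \in S -> #|S :\ e| = k.
  by move=> eS; have := cardsD1 e S; rewrite eS cS => -[].
have [/existsP[f /andP[fS /forall_inP Hf]] | no] := boolP [exists f, (f \in S) &&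
    [forall w in D, forall x in S, (x != f) ==> prefers w x f]].
  apply: (convexity_add_bottom fS) => [w x wD xS xf|].
    by have /forall_inP/(_ x xS)/implyP/(_ xf) := Hf w wD.
  by apply: IH; [exact: cS1 | exact: triples_spS (subD1set _ _) tri].
have others f : f \in S -> exists w e, [/\ w \in D, e \in S, e != f
    & forall y, y \in S -> y != e -> prefers w y e].
  move=> fS; move: no => /existsPn/(_ f); rewrite fS /= => /forall_inPn[w wD].
  move=> /forall_inPn[x xS]; rewrite negb_imply => /andP[xf nx].
  have [e eS He] := last_in w fS; exists w, e; split=> //.
  by apply: contraNneq nx => ef; rewrite -ef He // ef.
have /card_gt0P[x0 x0S] : 0 < #|S| by rewrite cS.
have [wf [f [wfD fS _ lf]]] := others _ x0S.
have [ws [s [wsD sS sf ls]]] := others _ fS.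
have fs : f != s by rewrite eq_sym.
(* s and f are bottoms of D, so neither is between in a triple with x. *)
have onlyfs w x : w \in D -> x \in S -> x != s -> x != f ->
    prefers w s x -> prefers w f x -> False.
  move=> wD xS xs xf psx pfx.
  have := tri _ _ _ sS fS xS sf; rewrite !(eq_sym _ x) xf xs => /(_ isT isT).
  have sx : s != x by rewrite eq_sym.
  have fx : f != x by rewrite eq_sym.
  rewrite (negPf (last_not_never wsD (ls _ fS fs) (ls _ xS xs))).
  rewrite (negPf (last_not_never wfD (lf _ sS sf) (lf _ xS xf))).
  by rewrite (negPf (last_not_never wD psx pfx)).
have [B1 [cB1 /subsetP DB1]] := IH _ D (cS1 _ fS) (triples_spS (subD1set _ _) tri).
pose D1 := D :|: (obeying (S :\ f) B1 :&: [set w | [forall x in S :\ f, prefers w x f]]).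
have D1P w x : w \in D1 -> w \notin D -> x \in S :\ f -> prefers w x f.
  case/setUP => [-> // | /setIP[_]]; rewrite [w \in _]inE => /forall_inP H _.
  exact: H.
have D1B1 w : w \in D1 -> w \in obeying (S :\ f) B1.
  by case/setUP => [/DB1 // | /setIP[]].
have tri1 : triples_sp (S :\ s) D1.
  have keep x y z : x \in S :\ s -> y \in S :\ s -> z \in S :\ s -> y != x -> z != x ->
      f \in [:: x; y; z] -> never_last D y x z -> never_last D1 y x z.
    move=> /setD1P[xs xS] /setD1P[ys yS] /setD1P[zs zS] yx zx fT /never_lastP H.
    apply/never_lastP => w wD1 pyx pzx.
    have [wD | nD] := boolP (w \in D); first exact: H wD pyx pzx.
    have [xf | xf] := eqVneq x f.
      by apply: (H wf wfD); rewrite xf; apply: lf => //; rewrite -xf.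
    have pxf : prefers w x f by apply: (D1P _ _ wD1 nD); apply/setD1P.
    move: fT; rewrite !inE (eq_sym f x) (negPf xf) /=.
    by case/orP => /eqP fE; move: pxf; rewrite fE; apply/negP; apply: prefers_asym.
  move=> x y z xS yS zS xy yz xz.
  have yx : y != x by rewrite eq_sym.
  have zy : z != y by rewrite eq_sym.
  have zx : z != x by rewrite eq_sym.
  have inS a : a \in S :\ s -> a \in S by case/setD1P.
  have [fT | fT] := boolP (f \in [:: x; y; z]).
    have fT1 : f \in [:: y; x; z] by move: fT; rewrite !inE orbCA.
    have fT2 : f \in [:: z; x; y] by move: fT; rewrite !inE orbA orbC.
    have /or3P[H|H|H] := tri _ _ _ (inS _ xS) (inS _ yS) (inS _ zS) xy yz xz.
    - by rewrite keep.
    - by rewrite [never_last D1 x y z]keep ?orbT.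
    - by rewrite [never_last D1 x z y]keep ?orbT.
  have nf a : a \in [:: x; y; z] -> a \in S :\ s -> a \in S :\ f.
    move=> aT /inS aS; apply/setD1P; split=> //.
    by apply: contraNneq fT => <-.
  have [xS' yS' zS'] : [/\ x \in S :\ f, y \in S :\ f & z \in S :\ f].
    by split; apply: nf => //; rewrite !inE eqxx ?orbT.
  have sD1 : D1 \subset obeying (S :\ f) B1 by apply/subsetP.
  have nl a b c : a \in S :\ f -> b \in S :\ f -> c \in S :\ f ->
      a != b -> c != b -> a != c -> B1 a b c -> never_last D1 a b c.
    by move=> *; apply: never_lastS sD1 _; rewrite never_last_obeying.
  by have /or3P[] := between_total cB1 xS' yS' zS' xy yz xz;
    move/nl => -> //; rewrite ?orbT.
have [B2 [cB2 /subsetP DB2]] := IH _ D1 (cS1 _ sS) tri1.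
have subD1 w : w \in D -> w \in D1 by rewrite inE => ->.
have E1 : extreme B1 (S :\ f) s.
  split=> [|u v uS vS us vs uv]; first exact/setD1P.
  have /obeyingP ow := DB1 _ wsD; apply: ow => //; first exact/setD1P.
    by apply: ls => //; case/setD1P: uS.
  by apply: ls => //; case/setD1P: vS.
have E2 : extreme B2 (S :\ s) f.
  split=> [|u v uS vS us vs uv]; first exact/setD1P.
  have /obeyingP ow := DB2 _ (subD1 _ wfD); apply: ow => //; first exact/setD1P.
    by apply: lf => //; case/setD1P: uS.
  by apply: lf => //; case/setD1P: vS.
have [|B [cB BE1 BE2 BE3]] := convexity_glue sS fS sf cB1 cB2 E1 E2.
  move=> x y z /setD1P[xf /setD1P[xs xS]] /setD1P[yf /setD1P[ys yS]].
  move=> /setD1P[zf /setD1P[zs zS]] xy yz xz Bxyz.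
  have S1 a : a \in S -> a != f -> a \in S :\ f by move=> *; apply/setD1P.
  have S2 a : a \in S -> a != s -> a \in S :\ s by move=> *; apply/setD1P.
  have realize a b c : a \in S -> b \in S -> c \in S -> a != f -> b != f -> c != f ->
      a != s -> b != s -> c != s -> a != b -> b != c -> a != c -> ~~ B1 a c b -> ~~ B2 a c b.
    move=> aS bS cSS af bf cf sa sb sc ab bc ac nB.
    have [w [wD pab pbc out]] := extend_triple cB1 (S1 _ aS af) (S1 _ bS bf)
      (S1 _ cSS cf) ab bc ac nB.
    have /DB2/obeyingP ow : w \in D1.
      apply/setUP; right; apply/setIP; split=> //; rewrite inE; apply/forall_inP => d dS.
      by apply: out dS _; rewrite !inE eqxx.
    by apply: ow; rewrite ?S2 //; apply: prefers_trans pab pbc.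
  have yx : y != x by rewrite eq_sym.
  have zy : z != y by rewrite eq_sym.
  have zx : z != x by rewrite eq_sym.
  have := between_total cB2 (S2 _ xS xs) (S2 _ yS ys) (S2 _ zS zs) xy yz xz.
  have n1 : ~~ B1 y x z.
    apply: contraTN Bxyz; exact: (between_excl cB1 (S1 _ xS xf) (S1 _ yS yf) (S1 _ zS zf) xy yz xz).
  have n2 : ~~ B1 x z y.
    rewrite (between_sym cB1).
    apply: contraTN Bxyz => H; rewrite (between_sym cB1).
    by apply: (between_excl cB1 (S1 _ zS zf) (S1 _ yS yf) (S1 _ xS xf) zy yx zx).
  rewrite (negPf (realize _ _ _ _ _ _ _ _ _ _ _ _ _ _ _ n1)) //.
  by rewrite (negPf (realize _ _ _ _ _ _ _ _ _ _ _ _ _ _ _ n2)) // orbF.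
exists B; split=> //; apply/subsetP => w wD; apply/obeyingP => u x v uS xS vS uv pu pv.
have ux := prefers_neq pu; have vx := prefers_neq pv.
have [fT | fT] := boolP (f \in [:: u; x; v]); last first.
  move: fT; rewrite !inE !negb_or ![f == _]eq_sym => /and3P[uf xf vf].
  by rewrite BE1 //; have /obeyingP ow := DB1 _ wD; apply: ow => //; apply/setD1P.
have [sT | sT] := boolP (s \in [:: u; x; v]); last first.
  move: sT; rewrite !inE !negb_or ![s == _]eq_sym => /and3P[us xs vs].
  by rewrite BE2 //; have /obeyingP ow := DB2 _ (subD1 _ wD); apply: ow => //; apply/setD1P.
rewrite BE3 //; apply/negP => /andP[xs xf].
move: fT sT; rewrite !inE !(eq_sym _ x) (negPf xs) (negPf xf) /=.
case/orP => /eqP fE /orP[]/eqP sE; first by rewrite fE sE eqxx in fs.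
- by apply: (onlyfs w x); rewrite ?fE ?sE // -?fE -?sE.
- by apply: (onlyfs w x); rewrite ?fE ?sE // -?fE -?sE.
by rewrite fE sE eqxx in fs.
Qed.

End Structure.

(** * Maximal Arrow's single-peaked domains and their extremal paths *)

Section MaximalDomains.
Variable A : finType.
Implicit Types (B : A -> A -> A -> bool) (D : {set linorder A}) (w : linorder A).

Lemma uniq3 (x y z : A) : uniq [:: x; y; z] = [&& x != y, y != z & x != z].
Proof. by rewrite /= !inE negb_or andbT; do 3 case: eqP. Qed.

Lemma never_bottom_never_last D u x v : u != x -> v != x ->
  never_bottom D [set u; x; v] x -> never_last D u x v.
Proof.
move=> ux vx /andP[_ /forall_inP H]; apply/never_lastP => w wD pu pv.
have /negP := H w wD; apply; rewrite /ranks_last !inE eqxx orbT /=.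
apply/forall_inP => y; rewrite !inE => /orP[/pred2P[]|/eqP] -> //;
  by rewrite ?pu ?pv ?eqxx ?implybT.
Qed.

Lemma never_last_never_bottom D u x v : u != x -> v != x ->
  never_last D u x v -> never_bottom D [set u; x; v] x.
Proof.
move=> ux vx /never_lastP H; rewrite /never_bottom !inE eqxx orbT /=.
apply/forall_inP => w wD; apply/negP => /andP[_ /forall_inP R].
have := R u; have := R v; rewrite !inE !eqxx ux vx !orbT /=.
by move=> /(_ isT) pv /(_ isT) pu; apply: (H w).
Qed.

Lemma arrow_sp_triples D : arrow_sp D -> triples_sp [set: A] D.
Proof.
move=> /andP[_ /forallP H] x y z _ _ _ xy yz xz.
have cT : #|[set x; y; z]| == 3.
  by rewrite setUC cardsU1 cards2 xy !inE negb_or ![z == _]eq_sym xz yz.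
have /existsP[e] := implyP (H [set x; y; z]) cT.
move=> He; have : e \in [set x; y; z] by case/andP: He.
have yx : y != x by rewrite eq_sym.
have zy : z != y by rewrite eq_sym.
have zx : z != x by rewrite eq_sym.
rewrite !inE -orbA => /or3P[]/eqP ee; rewrite ee in He.
- by rewrite never_bottom_never_last // [[set y; x]]setUC.
- by rewrite [never_last D x y z]never_bottom_never_last ?orbT.
- by rewrite [never_last D x z y]never_bottom_never_last ?orbT // setUAC.
Qed.

Lemma condorcet_obeying B : convexity [set: A] B -> condorcet (obeying [set: A] B).
Proof.
move=> cB; apply/negP => /exists_inP[u /obeyingP ou /exists_inP[v /obeyingP ov]].
move=> /exists_inP[w /obeyingP ow /existsP[a /existsP[b /existsP[c]]]].
rewrite uniq3 => /and4P[/and3P[ab bc ac] /andP[u1 u2] /andP[v1 v2] /andP[w1 w2]].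
have := between_total cB (in_setT a) (in_setT b) (in_setT c) ab bc ac.
have nBc := ou a c b (in_setT _) (in_setT _) (in_setT _) ab (prefers_trans u1 u2) u2.
have nBa := ov b a c (in_setT _) (in_setT _) (in_setT _) bc (prefers_trans v1 v2) v2.
have := ow c b a (in_setT _) (in_setT _) (in_setT _) _ (prefers_trans w1 w2) w2.
rewrite (between_sym cB) eq_sym => /(_ ac) nBb.
by rewrite (negPf nBa) (negPf nBb) (negPf nBc).
Qed.

Lemma arrow_sp_obeying B : convexity [set: A] B -> arrow_sp (obeying [set: A] B).
Proof.
move=> cB; rewrite /arrow_sp condorcet_obeying //; apply/forall_inP => T /eqP cT.
have [x [y [z [xy yz xz ->]]]] : exists x y z, [/\ x != y, y != z, x != z & T = [set x; y; z]].
  have := enum_uniq (mem T); have := cT; rewrite cardE.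
  case E: (enum T) => [|x [|y [|z [|? ?]]]] // _; rewrite uniq3 => /and3P[xy yz xz].
  exists x, y, z; split=> //; apply/setP => a.
  by rewrite -mem_enum E !inE orbA.
have yx : y != x by rewrite eq_sym.
have zy : z != y by rewrite eq_sym.
have zx : z != x by rewrite eq_sym.
have nb a b c : a != b -> c != b -> a != c -> B a b c ->
    never_bottom (obeying [set: A] B) [set a; b; c] b.
  by move=> ab cb ac Bb; apply: never_last_never_bottom; rewrite // never_last_obeying ?in_setT.
have /or3P[] := between_total cB (in_setT x) (in_setT y) (in_setT z) xy yz xz => /nb.
- by move=> H; apply/existsP; exists x; rewrite [[set x; y]]setUC H.
- by move=> H; apply/existsP; exists y; rewrite H.
- by move=> H; apply/existsP; exists z; rewrite setUAC H.
Qed.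

(** An order w violating the convexity on a triple, say ranking it u, v, x with
    x between u and v, completes a Condorcet cycle with the orders v, x, u and
    x, u, v, which are allowed and hence present. *)
Lemma max_arrow_sp_obeying B : convexity [set: A] B ->
  max_arrow_sp (obeying [set: A] B).
Proof.
move=> cB; rewrite /max_arrow_sp arrow_sp_obeying //=; apply/maxsetP.
split=> [|D cD sub]; first exact: condorcet_obeying.
apply/eqP; rewrite eqEsubset sub andbT; apply/subsetP => w wD.
have noviol u x v : prefers w u v -> prefers w v x -> ~~ B u x v.
  move=> uv vx; apply/negP => Bx.
  have ux := prefers_trans uv vx.
  have [nuv nvx nux] := And3 (prefers_neq uv) (prefers_neq vx) (prefers_neq ux).
  have nxv : x != v by rewrite eq_sym.
  have nxu : x != u by rewrite eq_sym.
  have nvu : v != u by rewrite eq_sym.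
  have nB1 : ~~ B v u x.
    by apply: contraTN Bx; rewrite (between_sym cB); apply: (between_excl cB).
  have nB2 : ~~ B x v u.
    by apply: contraTN Bx; rewrite [B u x v](between_sym cB); apply: (between_excl cB).
  have [w1 [w1D p1 p2 _]] := extend_triple cB (in_setT v) (in_setT x) (in_setT u) nvx nxu nvu nB1.
  have [w2 [w2D q1 q2 _]] := extend_triple cB (in_setT x) (in_setT u) (in_setT v) nxu nuv nxv nB2.
  have := cD; rewrite /condorcet => /negP; apply.
  apply/exists_inP; exists w => //; apply/exists_inP; exists w1; first exact: (subsetP sub).
  apply/exists_inP; exists w2; first exact: (subsetP sub).
  apply/existsP; exists u; apply/existsP; exists v; apply/existsP; exists x.
  by rewrite uniq3 nuv nvx nux /ranks3 uv vx p1 p2 q1 q2.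
apply/obeyingP => u x v _ _ _ uv pu pv.
have [p | p] := boolP (prefers w u v); first exact: noviol.
by rewrite (between_sym cB); apply: noviol pu; apply: prefers_total.
Qed.

Theorem max_arrow_spP D : max_arrow_sp D <->
  exists B, convexity [set: A] B /\ D = obeying [set: A] B.
Proof.
split=> [/andP[aD /maxsetP[_ mD]] | [B [cB ->]]]; last exact: max_arrow_sp_obeying.
have [B [cB sub]] := triples_sp_convexity (arrow_sp_triples aD).
by exists B; split=> //; rewrite (mD _ _ sub) // condorcet_obeying.
Qed.

Lemma obeying_eq B B' :
  (forall u x v, u != x -> v != x -> u != v -> B u x v = B' u x v) ->
  obeying [set: A] B = obeying [set: A] B'.
Proof.
move=> H; apply/setP => w; apply/obeyingP/obeyingP => ow u x v uT xT vT uv pu pv.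
  by rewrite -H ?(prefers_neq pu) ?(prefers_neq pv) //; apply: ow.
by rewrite H ?(prefers_neq pu) ?(prefers_neq pv) //; apply: ow.
Qed.

(** For an extreme element e, any order of the remaining elements that respects
    the convexity may be followed by e. *)
Lemma terminals_obeying B : convexity [set: A] B -> forall e,
  reflect (extreme B [set: A] e) (e \in terminals (obeying [set: A] B)).
Proof.
move=> cB e; rewrite inE; apply: (iffP exists_inP) => [[w /obeyingP ow /last_loP le] | [_ ee]].
  split; rewrite ?in_setT // => u v uT vT ue ve uv.
  by apply: ow => //; rewrite ?in_setT //; apply: le.
have cB' := convexityS (subsetT ([set: A] :\ e)) cB.
have [|||w [/obeyingP ow _ out]] := @extend_lo _ _ _ [::] cB' => //.
have le y : y != e -> prefers w y e.
  by move=> ye; apply: out; rewrite !inE ?eqxx ?ye.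
exists w; last exact/last_loP.
apply/obeyingP => u x v uT xT vT uv pu pv.
have ne y : prefers w y x -> x != e -> y != e.
  move=> yx xe; apply: contraTneq yx => ->; apply: prefers_asym; exact: le.
have [xe | xe] := eqVneq x e.
  by rewrite xe; apply: ee; rewrite // -xe ?(prefers_neq pu) ?(prefers_neq pv).
by apply: ow => //; rewrite in_setD1 ?xe ?(ne u) ?(ne v) ?in_setT.
Qed.

Lemma ends_neq w x y : 1 < #|A| -> head x w == x -> last y w == y -> x != y.
Proof.
rewrite head_lo last_lo => cA /eqP hx /eqP ly; apply: contraTneq cA => xy.
by rewrite -leqNgt; move: ly; rewrite -xy hx; lia.
Qed.

Lemma extremal_pathP B w x : convexity [set: A] B -> 1 < #|A| -> head x w == x ->
  reflect (w \in obeying [set: A] B /\ extreme B [set: A] x)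
          (w \in extremal_paths (obeying [set: A] B)).
Proof.
move=> cB cA hx; rewrite [w \in extremal_paths _]inE.
apply: (iffP andP) => [[wD /existsP[a /existsP[b /and4P[ab /eqP tE ha lb]]]] | [wD ex]].
  have xa : x = a.
    by apply: (@index_lo_inj _ w); move: hx ha; rewrite !head_lo => /eqP-> /eqP->.
  by split=> //; apply/(terminals_obeying cB); rewrite tE xa !inE eqxx.
split=> //; have [y ly] : exists y, last y w == y.
  by exists (last x w); case: (tval w : seq A).
have xy := ends_neq cA hx ly.
have ey : extreme B [set: A] y.
  by apply/(terminals_obeying cB); rewrite inE; apply/exists_inP; exists w.
apply/existsP; exists x; apply/existsP; exists y; rewrite xy hx ly !andbT /=.
rewrite eqEsubset; apply/andP; split; apply/subsetP => z.
  move/(terminals_obeying cB) => ez; rewrite !inE; have [//|zx] := eqVneq z x.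
  have [//|zy] := eqVneq z y; have xz := three_extremes cB ex ey ez xy.
  by rewrite eq_sym zy in xz; rewrite xz ?eqxx in zx.
by case/set2P => ->; apply/(terminals_obeying cB).
Qed.

(** If w ranks y above z, it ranks z last among x, y and z, so z is not between,
    and neither is the extreme x; hence y is.  As v also starts at x, ranking z
    above y would put y last. *)
Lemma extreme_head_inj B w v x : convexity [set: A] B -> extreme B [set: A] x ->
  w \in obeying [set: A] B -> v \in obeying [set: A] B ->
  head x w == x -> head x v == x -> w = v.
Proof.
move=> cB [_ ex] /obeyingP ow /obeyingP ov hw hv; apply: lo_ext => y z pyz.
have yz := prefers_neq pyz.
have zx : z != x.
  by apply: contraTneq pyz => ->; move: hw; rewrite head_lo /prefers => /eqP->.
have [-> | yx] := eqVneq y x; first exact: head_lo_prefers.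
have xy : x != y by rewrite eq_sym.
have pxy := head_lo_prefers hv yx.
have := between_total cB (in_setT x) (in_setT y) (in_setT z) xy yz.
rewrite (negPf (ex _ _ _ _ _ _ _)) ?in_setT // eq_sym zx => /(_ isT) /=.
rewrite (negPf (ow _ _ _ _ _ _ _ (head_lo_prefers hw zx) pyz)) ?in_setT // orbF => Bxyz.
apply/negPn/negP => /(prefers_total yz) pzy.
have xz : x != z by rewrite eq_sym.
by have := ov _ _ _ (in_setT x) (in_setT y) (in_setT z) xz pxy pzy; rewrite Bxyz.
Qed.

End MaximalDomains.

Lemma convexity_pull (I A : finType) (g : I -> A) (B : A -> A -> A -> bool) :
  injective g -> convexity [set: A] B ->
  convexity [set: I] (fun i x l => B (g i) (g x) (g l)).
Proof.
move=> gI cB; split=> [u x v | x y z _ _ _ xy yz xz | T _ x y xT yT xy].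
- exact: between_sym cB _ _ _.
- by apply: (between_total cB); rewrite ?in_setT ?(inj_eq gI).
have [|e1 [e2 [ne []]]] := two_extremes cB (subsetT (g @: T)) (imset_f g xT) (imset_f g yT).
  by rewrite (inj_eq gI).
move=> /imsetP[i1 i1T eq1] H1 [/imsetP[i2 i2T eq2] H2]; subst e1 e2.
exists i1, i2; rewrite -(inj_eq gI); split=> //; split=> // u v uT vT ui vi uv;
  [apply: H1 | apply: H2]; by rewrite ?(inj_eq gI) //; apply: imset_f.
Qed.

(** * The permutation and the core, in terms of positions along P *)

Section RankArithmetic.
Variables (k j : nat).
Hypothesis j12 : (j == 1) || (j == 2).

(** The action of theta on positions along P when #|A| = k + 5: s and f stand at
    0 and k + 4, the last a_i at k + 3, and the element exchanged with it at j. *)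
Definition rank_swap r :=
  if r == 0 then k + 4 else if r == k + 4 then 0
  else if r == j then k + 3 else if r == k + 3 then j else r.

(** The core consists of the positions 1, ..., k + 2.  [rank_in] lists them in
    the order of the path that starts at position j and otherwise follows P;
    3 - j is the one of 1 and 2 other than j. *)
Definition rank_in i := if i == 0 then j else if i == 1 then 3 - j else i.+1.
Definition rank_out r := if r == j then 0 else if r == 3 - j then 1 else r.-1.

Let jP : j = 1 \/ j = 2.
Proof. by case/orP: j12 => /eqP; [left | right]. Qed.

Let j_gt0 : 0 < j.
Proof. by case: jP => ->. Qed.

Let j_le2 : j <= 2.
Proof. by case: jP => ->. Qed.

Let j_lt : j < k + 3.
Proof. by rewrite (leq_ltn_trans j_le2) // !addnS. Qed.

Lemma rank_swapE r : [\/ r = 0 /\ rank_swap r = k + 4, r = k + 4 /\ rank_swap r = 0,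
  r = j /\ rank_swap r = k + 3 | r = k + 3 /\ rank_swap r = j] \/
  [/\ r <> 0, r <> k + 4, r <> j, r <> k + 3 & rank_swap r = r].
Proof.
rewrite /rank_swap; case: eqP => [->|r0]; first by left; apply: Or41.
case: eqP => [->|r4]; first by left; apply: Or42.
case: eqP => [->|rj]; first by left; apply: Or43.
by case: eqP => [->|r3]; [left; apply: Or44 | right].
Qed.

Lemma rank_swap0 : rank_swap 0 = k + 4.
Proof. by []. Qed.

Lemma rank_swap_top : rank_swap (k + 4) = 0.
Proof. by rewrite /rank_swap addn_eq0 andbF eqxx. Qed.

Lemma rank_swap_j : rank_swap j = k + 3.
Proof. by rewrite /rank_swap eqxx gtn_eqF // ltn_eqF // (ltn_trans j_lt) // ltn_add2l. Qed.

Lemma rank_swap_twin : rank_swap (k + 3) = j.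
Proof. by rewrite /rank_swap eqn_add2l addn_eq0 andbF (gtn_eqF j_lt) eqxx. Qed.

Lemma rank_swapK r : rank_swap (rank_swap r) = r.
Proof.
have [[[-> ->]|[-> ->]|[-> ->]|[-> ->]]|[_ _ _ _ rE]] := rank_swapE r.
- exact: rank_swap_top.
- exact: rank_swap0.
- exact: rank_swap_twin.
- exact: rank_swap_j.
- by rewrite !rE.
Qed.

Lemma rank_swap_fixed_below u x : u < x -> x < k + 3 -> rank_swap u < rank_swap x ->
  rank_swap x = x -> rank_swap u = u.
Proof.
move=> ux x3 su sx; rewrite sx in su.
have [[[_ uE]|[uE _]|[_ uE]|[uE _]]|[_ _ _ _ //]] := rank_swapE u; exfalso; lia.
Qed.

(** Here x is last of the triple along P and along Q.  It is not 0 or k + 4,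
    which are first along one of the two.  If x = j, only positions 0 and 1 are
    smaller, so u or v is 0, which Q puts last; x = k + 3 is the same with P and
    Q exchanged.  So x is fixed, and then u and v, being below x along both
    paths, are none of the moved positions. *)
Lemma rank_swap_last_fixed u x v : u < k + 5 -> x < k + 5 -> v < k + 5 -> u <> v ->
  u < x -> v < x -> rank_swap u < rank_swap x -> rank_swap v < rank_swap x ->
  [/\ rank_swap u = u, rank_swap x = x & rank_swap v = v].
Proof.
move=> u5 x5 v5 uv ux vx su sv.
have [[[xE _]|[_ sxE]|[xE sxE]|[xE sxE]]|[_ x4 _ x3 xE]] := rank_swapE x.
- by rewrite xE in ux.
- by rewrite sxE in su.
- have [u0 | v0] : u = 0 \/ v = 0 by lia.
    by rewrite u0 sxE rank_swap0 ltn_add2l in su.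
  by rewrite v0 sxE rank_swap0 ltn_add2l in sv.
- have suv : rank_swap u <> rank_swap v by move/(congr1 rank_swap); rewrite !rank_swapK.
  have [u0 | v0] : rank_swap u = 0 \/ rank_swap v = 0 by lia.
    by move: ux; rewrite -(rank_swapK u) u0 xE rank_swap0 ltn_add2l.
  by move: vx; rewrite -(rank_swapK v) v0 xE rank_swap0 ltn_add2l.
have x_lt : x < k + 3 by lia.
have below := @rank_swap_fixed_below _ x _ x_lt.
by split=> //; [exact: below ux su xE | exact: below vx sv xE].
Qed.

Lemma rank_inE i : [\/ i = 0 /\ rank_in i = j, i = 1 /\ rank_in i = 3 - j |
  1 < i /\ rank_in i = i.+1].
Proof.
rewrite /rank_in; case: i => [|[|i]] /=; [exact: Or31 | exact: Or32 | exact: Or33].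
Qed.

Lemma rank_in_gt0 i : 0 < rank_in i.
Proof. by have [[_ ->]|[_ ->]|[_ ->]] := rank_inE i; rewrite ?subn_gt0. Qed.

Lemma rank_in_bounds i : i < k.+2 -> 0 < rank_in i < k + 3.
Proof. by move=> ik; have [[_ ->]|[_ ->]|[i1 ->]] := rank_inE i; lia. Qed.

Lemma rank_inK i : rank_out (rank_in i) = i.
Proof.
rewrite /rank_out; case: i => [|[|i]]; rewrite /rank_in /= ?eqxx //.
  by case: jP => ->.
by case: jP => ->.
Qed.

Lemma rank_outK r : 0 < r -> rank_in (rank_out r) = r.
Proof.
move=> r0; rewrite /rank_out; case: eqP => [->//|rj]; case: eqP => [->//|r3].
by case: jP r0 rj r3 => ->; case: r => [|[|[|r]]].
Qed.

Lemma rank_out_lt r : 0 < r < k + 3 -> rank_out r < k.+2.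
Proof. by move=> r3; rewrite /rank_out; case: eqP => // _; case: eqP => // _; lia. Qed.

Lemma rank_in_lt x y : 1 < x -> (rank_in y < rank_in x) = (y < x).
Proof.
case: x => [|[|x]] // _.
rewrite {2}/rank_in /=; have [[-> ->]|[-> ->]|[_ ->]] := rank_inE y => //.
  by rewrite (leq_ltn_trans j_le2).
by rewrite (leq_ltn_trans (leq_sub2l 3 j_gt0)).
Qed.

(** The two paths through the core differ only in their first two entries, so
    they have the same last element on each triple. *)
Lemma rank_in_last u x v : u <> v ->
  (rank_in u < rank_in x) && (rank_in v < rank_in x) = (u < x) && (v < x).
Proof.
move=> uv; have [x1 | x1] := ltnP 1 x; first by rewrite !rank_in_lt.
have rx : rank_in x <= 2 by case: x x1 => [|[|]] //= _; rewrite /rank_in /= leq_subLR addn2.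
transitivity false; [|symmetry]; apply/negP => /andP[lu lv]; apply: uv.
  have one i : rank_in i < rank_in x -> rank_in i = 1.
    by move/leq_trans => /(_ _ rx); case: (rank_in i) (rank_in_gt0 i) => [|[|]].
  by rewrite -(rank_inK u) -(rank_inK v) (one u lu) (one v lv).
have zero i : i < x -> i = 0 by move/leq_trans => /(_ _ x1); case: i.
by rewrite (zero u lu) (zero v lv).
Qed.

Lemma rank_swap_in_eq0 : rank_swap (rank_in 0) = k + 3.
Proof. exact: rank_swap_j. Qed.

Lemma rank_swap_in i : i < k.+2 -> i <> 0 -> rank_swap (rank_in i) = rank_in i.
Proof.
move=> ik i0; have [[//]|[_ iE]|[i1 iE]] := rank_inE i.
  have [[[e _]|[e _]|[e _]|[e _]]|[_ _ _ _ //]] := rank_swapE (rank_in i);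
    rewrite iE in e; case: jP => ej; lia.
have [[[e _]|[e _]|[e _]|[e _]]|[_ _ _ _ //]] := rank_swapE (rank_in i); lia.
Qed.

Lemma rank_swap_in0 u : u < k.+2 -> u <> 0 ->
  rank_swap (rank_in u) < rank_swap (rank_in 0).
Proof.
move=> uk u0; rewrite rank_swap_in_eq0 rank_swap_in //.
by have /andP[] := rank_in_bounds uk.
Qed.

(** Along Q, too, the core is ordered as along P, except that the position j,
    which is [rank_in 0], goes last. *)
Lemma rank_swap_in_last u x v : u < k.+2 -> x < k.+2 -> v < k.+2 -> u <> v ->
  rank_swap (rank_in u) < rank_swap (rank_in x) ->
  rank_swap (rank_in v) < rank_swap (rank_in x) -> x = 0 \/ u < x /\ v < x.
Proof.
move=> uk xk vk uv; have [-> | /eqP x0] := eqVneq x 0; first by left.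
have low y : y < k.+2 -> rank_swap (rank_in y) < rank_swap (rank_in x) ->
    rank_in y < rank_in x.
  move=> yk; rewrite (rank_swap_in xk x0); have [-> | /eqP y0] := eqVneq y 0.
    rewrite rank_swap_in_eq0 => /ltnW; rewrite leqNgt.
    by have /andP[_ ->] := rank_in_bounds xk.
  by rewrite rank_swap_in.
move=> /(low _ uk) lu /(low _ vk) lv; right; apply/andP.
by rewrite -(rank_in_last _ uv) lu.
Qed.

End RankArithmetic.

(** * Domains with extremal paths P and theta(P) *)

Section LastOfThree.
Variable A : finType.
Implicit Types (w : linorder A) (B : A -> A -> A -> bool).

Definition last3 (w : linorder A) u x v := prefers w u x && prefers w v x.

Lemma last3C w u x v : last3 w u x v = last3 w v x u.
Proof. exact: andbC. Qed.

Lemma last3_total w x y z : x != y -> y != z -> x != z ->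
  [|| last3 w y x z, last3 w x y z | last3 w x z y].
Proof.
move=> xy yz xz; rewrite /last3.
have [pxy | /(prefers_total xy) pyx] := boolP (prefers w x y).
  have [pyz | /(prefers_total yz) pzy] := boolP (prefers w y z); last by rewrite pzy orbT.
  by rewrite (prefers_trans pxy pyz) !orbT.
have [pxz | /(prefers_total xz) pzx] := boolP (prefers w x z); last by rewrite pyx pzx.
by rewrite (prefers_trans pyx pxz) !orbT.
Qed.

Lemma last3_unique w x y z : last3 w y x z -> ~~ last3 w x y z.
Proof. by case/andP => pyx _; apply/negP => /andP[/prefers_asym]; rewrite pyx. Qed.

Lemma obeying_last3 w B u x v : u != v -> w \in obeying [set: A] B ->
  last3 w u x v -> ~~ B u x v.
Proof. by move=> uv /obeyingP ow /andP[pu pv]; apply: ow. Qed.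

End LastOfThree.

Section TwinDomains.
Variables (A : finType) (s : A) (k j : nat) (P : linorder A) (theta : {perm A}).
Hypothesis j12 : (j == 1) || (j == 2).
Hypothesis cardA : #|A| = k + 5.
Hypothesis theta_rank : forall x, index (theta x) P = rank_swap k j (index x P).

Local Notation Q := (perm_path theta P).
Local Notation rank x := (index x (tval (lo_tuple P))).
Local Notation swap := (rank_swap k j).
Implicit Types (B : A -> A -> A -> bool) (C : 'I_k.+2 -> 'I_k.+2 -> 'I_k.+2 -> bool).

Lemma rank_lt x : rank x < k + 5.
Proof. by rewrite -cardA index_lo_lt. Qed.

Lemma theta_inv x : theta (theta x) = x.
Proof. by apply: (@index_lo_inj _ P); rewrite /= !theta_rank rank_swapK. Qed.

Lemma prefers_perm_path (w : linorder A) x y :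
  prefers (perm_path theta w) (theta x) (theta y) = prefers w x y.
Proof. by rewrite /prefers /= !index_map //; apply: perm_inj. Qed.

Lemma prefers_perm_path_inv (w : linorder A) x y :
  prefers (perm_path theta w) x y = prefers w (theta x) (theta y).
Proof. by rewrite -{1}(theta_inv x) -{1}(theta_inv y) prefers_perm_path. Qed.

Lemma rankQ x : index x Q = swap (rank x).
Proof.
by rewrite -[in LHS](theta_inv x) -theta_rank /= index_map //; apply: perm_inj.
Qed.

Lemma prefersP x y : prefers P x y = (rank x < rank y).
Proof. by []. Qed.

Lemma prefersQ x y : prefers Q x y = (swap (rank x) < swap (rank y)).
Proof. by rewrite /prefers !rankQ. Qed.

Lemma common_last_fixed u x v : u != v -> last3 P u x v -> last3 Q u x v ->
  [&& theta u == u, theta x == x & theta v == v].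
Proof.
move=> uv /andP[]; rewrite !prefersP => ux vx /andP[]; rewrite !prefersQ => su sv.
have nuv : rank u <> rank v by move/(@index_lo_inj _ P) => /eqP; rewrite (negPf uv).
have [eu ex ev] := rank_swap_last_fixed j12 (rank_lt u) (rank_lt x) (rank_lt v) nuv ux vx su sv.
by apply/and3P; split; apply/eqP/(@index_lo_inj _ P); rewrite /= theta_rank.
Qed.

Definition neither_last u x v := ~~ last3 P u x v && ~~ last3 Q u x v.

Definition compatible B := [/\ convexity [set: A] B,
  P \in obeying [set: A] B & Q \in obeying [set: A] B].

(** If theta moves some element of the triple, P and Q rank different elements
    last; neither of these is between, so the third one is. *)
Lemma compatible_neither_last B u x v : compatible B -> u != x -> v != x -> u != v ->
  ~~ [&& theta u == u, theta x == x & theta v == v] -> B u x v = neither_last u x v.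
Proof.
move=> [cB oP oQ] ux vx uv nfix; apply/idP/andP => [Bx | [nP nQ]].
  by split; apply: contraL Bx; apply: obeying_last3.
have xv : x != v by rewrite eq_sym.
have xu : x != u by rewrite eq_sym.
have diffu : last3 P x u v -> ~~ last3 Q x u v.
  move=> lP; apply: contra nfix => lQ.
  by have /and3P[-> -> ->] := common_last_fixed xv lP lQ.
have diffv : last3 P u v x -> ~~ last3 Q u v x.
  move=> lP; apply: contra nfix => lQ.
  by have /and3P[-> -> ->] := common_last_fixed ux lP lQ.
have := last3_total P ux xv uv; have := last3_total Q ux xv uv.
rewrite (negPf nP) (negPf nQ) /=.
have := between_total cB (in_setT u) (in_setT x) (in_setT v) ux xv uv.
have noP := fun a b c n => @obeying_last3 _ P B a b c n oP.
have noQ := fun a b c n => @obeying_last3 _ Q B a b c n oQ.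
case/or3P => // [Bu | Bv] /orP[lQ | lQ] /orP[lP | lP].
- by have := noP _ _ _ xv lP; rewrite Bu.
- by have := noQ _ _ _ xv lQ; rewrite Bu.
- by have := noP _ _ _ xv lP; rewrite Bu.
- by have := diffv lP; rewrite lQ.
- by have := diffu lP; rewrite lQ.
- by have := noP _ _ _ ux lP; rewrite Bv.
- by have := noQ _ _ _ ux lQ; rewrite Bv.
- by have := noP _ _ _ ux lP; rewrite Bv.
Qed.

(** theta exchanges P and Q, hence preserves being ranked last by neither. *)
Lemma compatible_theta B u x v : compatible B -> u != x -> v != x -> u != v ->
  B (theta u) (theta x) (theta v) = B u x v.
Proof.
move=> cB ux vx uv.
have [/and3P[/eqP-> /eqP-> /eqP->] // | nfix] :=
  boolP [&& theta u == u, theta x == x & theta v == v].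
have fixE a : (theta (theta a) == theta a) = (theta a == a).
  by rewrite (inj_eq perm_inj).
rewrite !compatible_neither_last ?(inj_eq perm_inj) ?fixE //.
by rewrite /neither_last /last3 !prefers_perm_path_inv !theta_inv andbC.
Qed.

Lemma theta_obeying B : compatible B ->
  [set perm_path theta w | w in obeying [set: A] B] = obeying [set: A] B.
Proof.
move=> cB; apply/eqP; rewrite eqEcard card_imset ?leqnn ?andbT.
  apply/subsetP => _ /imsetP[w /obeyingP ow ->]; apply/obeyingP => u x v _ _ _ uv.
  rewrite -/(prefers _ u x) -/(prefers _ v x) !prefers_perm_path_inv => pu pv.
  have ux := prefers_neq pu; have vx := prefers_neq pv.
  rewrite !(inj_eq perm_inj) in ux vx.
  rewrite -compatible_theta //.
  by apply: ow; rewrite ?in_setT ?(inj_eq perm_inj).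
move=> w v e; apply: lo_ext => x y.
by rewrite -(prefers_perm_path w) e prefers_perm_path.
Qed.

Lemma P_neq_Q : P != Q.
Proof.
apply/negP => /eqP e.
have sz : 0 < size P by rewrite size_tuple cardA addnS.
have := rankQ (nth s P 0); rewrite -e index_uniq ?lo_uniq //.
by rewrite /rank_swap /=; lia.
Qed.

(** P ends at the head of Q and Q at the head of P, so respecting a convexity
    already makes P and Q start at the two extreme elements. *)
Lemma domains_with_compatible D :
  D \in domains_with_extremal_paths P Q <->
  exists2 B, compatible B & D = obeying [set: A] B.
Proof.
have cA : 1 < #|A| by rewrite cardA !addnS.
have sz : size P = k + 5 by rewrite size_tuple.
have at_rank r : r < k + 5 -> exists x, rank x = r.
  by move=> lr; exists (nth s P r); rewrite index_uniq ?lo_uniq ?sz.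
have [|p0 rp0] := at_rank 0; first by rewrite addnS.
have [|q0 rq0] := at_rank (k + 4); first by rewrite ltn_add2l.
have hP : head p0 P == p0 by rewrite head_lo rp0.
have hQ : head q0 Q == q0.
  by rewrite head_lo rankQ rq0 /rank_swap; do !case: eqP => //; lia.
rewrite inE; split=> [/andP[/max_arrow_spP[B [cB ->]] /eqP eD] | [B [cB oP oQ] ->]].
  exists B => //; split=> //.
    have : P \in extremal_paths (obeying [set: A] B) by rewrite eD !inE eqxx.
    by case/(extremal_pathP cB cA hP).
  have : Q \in extremal_paths (obeying [set: A] B) by rewrite eD !inE eqxx orbT.
  by case/(extremal_pathP cB cA hQ).
rewrite max_arrow_sp_obeying //=.
have lastx (w : linorder A) x : w \in obeying [set: A] B -> index x w = k + 4 ->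
    extreme B [set: A] x.
  move=> wD ix; apply/(terminals_obeying cB); rewrite inE; apply/exists_inP.
  exists w => //; rewrite last_lo; move: cardA ix; lia.
have ep : extreme B [set: A] p0.
  apply: (lastx Q) => //; rewrite rankQ rp0 //.
have eq : extreme B [set: A] q0 by apply: (lastx P).
have pq : p0 != q0 by apply/eqP => e; move: rp0; rewrite e rq0 addnS.
rewrite eqEsubset; apply/andP; split; apply/subsetP => w; last first.
  by case/set2P => ->; [apply/(extremal_pathP cB cA hP) | apply/(extremal_pathP cB cA hQ)].
move=> we; have [x hx] : exists x, head x w == x.
  by exists (head p0 w); case: (tval w : seq A) => /=.
have [wD ex] := extremal_pathP cB cA hx we.
have [xp | xp] := eqVneq x p0.
  rewrite (extreme_head_inj cB ep wD oP _ hP) ?set21 //; first by rewrite -xp.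
have [xq | xq] := eqVneq x q0.
  rewrite (extreme_head_inj cB eq wD oQ _ hQ) ?set22 //; first by rewrite -xq.
have xp' := three_extremes cB ex ep eq xp pq.
by rewrite xp' eqxx in xq.
Qed.

Lemma twin_self_paired D : D \in domains_with_extremal_paths P Q -> self_paired D.
Proof.
move=> DX; have [B cB DE] := (domains_with_compatible D).1 DX.
apply/existsP; exists theta; rewrite {2 3}DE theta_obeying // eqxx andbT.
apply/existsP; exists P; apply/existsP; exists Q.
by move: DX; rewrite inE P_neq_Q eqxx => /andP[_ ->].
Qed.

(** Everything except s, f and the last a_i. *)
Definition core x := 0 < rank x < k + 3.
(** Identifies 'I_k.+2 with the core so that the standard order becomes the path
    starting at z.  All positions used are below the length of P, so the default
    s of [nth] does not occur. *)
Definition embed (i : 'I_k.+2) := nth s P (rank_in j i).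
(** The inverse of [embed] on the core; outside the core its value is junk. *)
Definition retract x : 'I_k.+2 := inord (rank_out j (rank x)).

Lemma rank_embed i : rank (embed i) = rank_in j i.
Proof.
have := rank_in_bounds j12 (ltn_ord i) => b.
by rewrite index_uniq ?lo_uniq // size_tuple; move: cardA b; lia.
Qed.

Lemma core_embed i : core (embed i).
Proof. by rewrite /core rank_embed rank_in_bounds. Qed.

Lemma embedK i : retract (embed i) = i.
Proof. by rewrite /retract rank_embed (rank_inK j12) inord_val. Qed.

Lemma retractK x : core x -> embed (retract x) = x.
Proof.
move=> cx; apply: (@index_lo_inj _ P); rewrite /= rank_embed.
by rewrite inordK ?(rank_out_lt j12 cx) // (rank_outK j12) //; case/andP: cx.
Qed.

Lemma embed_inj : injective embed.
Proof. exact: can_inj embedK. Qed.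

Lemma retract_neq x y : core x -> core y -> x != y -> retract x != retract y.
Proof. by move=> cx cy; apply: contra_neq => e; rewrite -(retractK cx) e retractK. Qed.

Lemma fixed_core x : theta x == x -> core x.
Proof.
rewrite -(inj_eq (@index_lo_inj _ P)) /= theta_rank /core => /eqP sE.
have := rank_lt x; have [] := rank_swapE k j (rank x); last first.
  by case=> r0 r4 _ r3 _ r5; move: (rank x) r0 r4 r3 r5 => r; lia.
have jk : j <> k + 3 by case/orP: j12 => /eqP ->; rewrite !addnS.
case=> -[rE]; rewrite sE rE => e _.
- by rewrite addnS in e.
- by rewrite addnS in e.
- by case: jk.
- by case: jk.
Qed.

Definition pull B i x l := B (embed i) (embed x) (embed l).
Definition lift C u x v :=
  if [&& core u, core x & core v] then C (retract u) (retract x) (retract v)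
  else neither_last u x v.

(** The convexities of the domains that share the standard order as an extremal
    path. *)
Definition represents C := [/\ convexity [set: 'I_k.+2] C,
  enum_linorder 'I_k.+2 \in obeying [set: 'I_k.+2] C
  & extreme C [set: 'I_k.+2] ord0].

Lemma prefers_enum (i l : 'I_k.+2) : prefers (enum_linorder 'I_k.+2) i l = (i < l).
Proof. by rewrite /prefers /= !index_enum_ord. Qed.

(** The standard order is respected because P is, and the element 0, which is z,
    is extreme because Q ranks it below the rest of the core. *)
Lemma pull_represents B : compatible B -> represents (pull B).
Proof.
move=> [cB oP oQ]; split; first exact: convexity_pull embed_inj cB.
  apply/obeyingP => u x v _ _ _ uv; rewrite -/(prefers _ u x) -/(prefers _ v x).
  rewrite !prefers_enum => ux vx; apply: (obeying_last3 _ oP).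
    by rewrite (inj_eq embed_inj).
  rewrite /last3 !prefersP !rank_embed (rank_in_last j12) ?ux //.
  by move/val_inj/eqP; apply/negP.
split=> [|u v _ _ u0 v0 uv]; first exact: in_setT.
apply: (obeying_last3 _ oQ); first by rewrite (inj_eq embed_inj).
by rewrite /last3 !prefersQ !rank_embed !(rank_swap_in0 j12) //;
  apply/eqP; rewrite (inj_eq val_inj _ ord0).
Qed.

Lemma lift_last3 C u x v : represents C -> u != v ->
  last3 P u x v || last3 Q u x v -> ~~ lift C u x v.
Proof.
move=> [cC oE ex0] uv lPQ; rewrite /lift; case: ifP => [/and3P[cu cx cv]|_]; last first.
  by rewrite /neither_last -negb_or lPQ.
have ruv := retract_neq cu cv uv.
have nuv : nat_of_ord (retract u) <> retract v by move/val_inj/eqP; apply/negP.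
have lastE : retract u < retract x -> retract v < retract x ->
    ~~ C (retract u) (retract x) (retract v).
  by move=> lu lv; apply: (obeying_last3 ruv oE); rewrite /last3 !prefers_enum lu.
move: lPQ; rewrite -(retractK cu) -(retractK cx) -(retractK cv).
rewrite /last3 !prefersP !prefersQ !rank_embed !embedK => /orP[].
  by rewrite (rank_in_last j12) // => /andP[]; apply: lastE.
case/andP => lu lv.
have [x0|[]] := rank_swap_in_last j12 (ltn_ord _) (ltn_ord _) (ltn_ord _) nuv lu lv;
  last exact: lastE.
have xE : retract x = ord0 by apply: val_inj.
rewrite xE in lu lv *.
by apply: (ex0.2); rewrite ?in_setT //; apply/eqP => e; rewrite ?e ltnn in lu lv.
Qed.

Lemma neither_last_total x y z : x != y -> y != z -> x != z ->
  [|| neither_last y x z, neither_last x y z | neither_last x z y].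
Proof.
move=> xy yz xz.
have atmost w : [&& ~~ (last3 w y x z && last3 w x y z),
    ~~ (last3 w y x z && last3 w x z y) & ~~ (last3 w x y z && last3 w x z y)].
  apply/and3P; split; apply/negP => /andP[l1 l2].
  - by have := last3_unique l1; rewrite l2.
  - by move: l1 l2; rewrite last3C => /last3_unique; rewrite last3C => /negPf->.
  - by move: l1 l2; rewrite last3C [last3 w x z y]last3C => /last3_unique/negPf->.
move: (atmost P) (atmost Q); rewrite /neither_last.
by case: (last3 P y x z); case: (last3 P x y z); case: (last3 P x z y);
  case: (last3 Q y x z); case: (last3 Q x y z); case: (last3 Q x z y).
Qed.

(** If T leaves the core, take the bottoms of T in P and in Q.  Were they equal,
    [common_last_fixed] would make theta fix every element of T, whereas an
    element outside the core is moved; this needs a third element in T, but in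
    a pair both elements are extreme anyway. *)
Lemma lift_two_extremes C (T : {set A}) x y : represents C -> x \in T -> y \in T -> x != y ->
  exists e1 e2, [/\ e1 != e2, extreme (lift C) T e1 & extreme (lift C) T e2].
Proof.
move=> rC xT yT xy; have [cC _ _] := rC.
have [/forall_inP coreT | /forall_inPn[t tT ncore]] := boolP [forall t in T, core t].
  have [] := two_extremes cC (subsetT (retract @: T)) (imset_f retract xT)
    (imset_f retract yT) (retract_neq (coreT _ xT) (coreT _ yT) xy).
  move=> f1 [f2 [ne []]] /imsetP[e1 e1T f1E] H1 [/imsetP[e2 e2T f2E] H2]; subst f1 f2.
  exists e1, e2; split; first by apply: contra_neq ne => ->.
  - split=> // u v uT vT ue ve uv; rewrite /lift !coreT //=.
    by apply: H1; rewrite ?imset_f ?retract_neq ?coreT.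
  - split=> // u v uT vT ue ve uv; rewrite /lift !coreT //=.
    by apply: H2; rewrite ?imset_f ?retract_neq ?coreT.
have [T2 | T3] := leqP #|T| 2.
  have TE : [set x; y] = T.
    by apply/eqP; rewrite eqEcard cards2 xy T2 andbT; apply/subsetP => a /set2P[]->.
  by exists x, y; split=> //; apply: (@extreme_pair _ _ _ x y); rewrite -?TE ?set21 ?set22.
have [p pT Hp] := last_in P xT; have [q qT Hq] := last_in Q xT.
have ep : extreme (lift C) T p.
  split=> // u v uT vT up vp uv; apply: lift_last3 => //.
  by rewrite /last3 !Hp.
have eq : extreme (lift C) T q.
  split=> // u v uT vT up vp uv; apply: lift_last3 => //.
  by rewrite /last3 [prefers Q _ _]Hq // [prefers Q _ _]Hq // orbT.
exists p, q; split=> //; apply: contraNneq ncore => pq.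
have fixed a : a \in T -> a != p -> (theta a == a) && (theta p == p).
  move=> aT ap; have /subsetPn[b bT] : ~~ (T \subset [set p; a]).
    apply: contraL T3 => /subset_leq_card; rewrite -leqNgt cards2 => /leq_trans; apply.
    by case: (p != a).
  rewrite !inE negb_or => /andP[bp ba].
  have ab : a != b by rewrite eq_sym.
  have /and3P[-> -> _] // : [&& theta a == a, theta p == p & theta b == b].
  by apply: common_last_fixed => //; rewrite /last3 ?Hp // pq !Hq // -pq.
have [tp | tp] := eqVneq t p; last by have /andP[/fixed_core] := fixed t tT tp.
have [xp | xp] := eqVneq x p.
  have yp : y != p by rewrite -xp eq_sym.
  by have /andP[_ /fixed_core] := fixed y yT yp; rewrite tp.
by have /andP[_ /fixed_core] := fixed x xT xp; rewrite tp.
Qed.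

Lemma lift_compatible C : represents C -> compatible (lift C).
Proof.
move=> rC; have [cC _ _] := rC; split.
- split=> [u x v | x y z _ _ _ xy yz xz | T _ x y]; last exact: lift_two_extremes.
    rewrite /lift (between_sym cC) /neither_last !(last3C _ u).
    by case: (core u); case: (core x); case: (core v).
  rewrite /lift; case cx: (core x); case cy: (core y); case cz: (core z) => /=;
    try exact: neither_last_total.
  by apply: (between_total cC); rewrite ?in_setT ?retract_neq.
- apply/obeyingP => u x v _ _ _ uv pu pv.
  by apply: lift_last3; rewrite // /last3 /prefers pu pv.
- apply/obeyingP => u x v _ _ _ uv pu pv.
  by apply: lift_last3; rewrite // orbC /last3 /prefers pu pv.
Qed.

Lemma pull_lift C i x l : pull (lift C) i x l = C i x l.
Proof. by rewrite /pull /lift !core_embed !embedK. Qed.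

Lemma lift_pull B u x v : compatible B -> u != x -> v != x -> u != v ->
  lift (pull B) u x v = B u x v.
Proof.
move=> cB ux vx uv; rewrite /lift; case: ifP => [/and3P[cu cx cv]|nc].
  by rewrite /pull !retractK.
rewrite compatible_neither_last //; apply: contraFN nc.
by move=> /and3P[/fixed_core-> /fixed_core-> /fixed_core->].
Qed.

Lemma lift_eq C C' :
  (forall u x v, u != x -> v != x -> u != v -> C u x v = C' u x v) ->
  forall u x v, u != x -> v != x -> u != v -> lift C u x v = lift C' u x v.
Proof.
move=> CC u x v ux vx uv; rewrite /lift; case: ifP => // /and3P[cu cx cv].
by rewrite CC ?retract_neq.
Qed.

Lemma domains_sharing_represents E :
  E \in domains_sharing (enum_linorder 'I_k.+2) <->
  exists2 C, represents C & E = obeying [set: 'I_k.+2] C.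
Proof.
have cI : 1 < #|'I_k.+2| by rewrite card_ord.
have hE : head ord0 (enum_linorder 'I_k.+2) == ord0 by rewrite head_lo /= index_enum_ord.
rewrite inE; split=> [/andP[/max_arrow_spP[C [cC ->]]] | [C [cC oE ex] ->]].
  by case/(extremal_pathP cC cI hE) => *; exists C.
by rewrite max_arrow_sp_obeying //; apply/(extremal_pathP cC cI hE).
Qed.

(** Restricting the betweenness of a domain to the core, and lifting back, are
    mutually inverse; [never_last] recovers the betweenness from the domain. *)
Theorem card_twin_domains : #|domains_with_extremal_paths P Q| = calP k.+2.
Proof.
pose restrict D : {set linorder 'I_k.+2} := obeying [set: 'I_k.+2] (pull (never_last D)).
pose extend E : {set linorder A} := obeying [set: A] (lift (never_last E)).
have restrictE B : compatible B ->
    restrict (obeying [set: A] B) = obeying [set: 'I_k.+2] (pull B).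
  move=> [cB _ _]; apply: obeying_eq => u x v ux vx uv.
  by rewrite /pull never_last_obeying ?in_setT ?(inj_eq embed_inj).
have extendE C : represents C ->
    extend (obeying [set: 'I_k.+2] C) = obeying [set: A] (lift C).
  move=> [cC _ _]; apply: obeying_eq; apply: lift_eq => u x v ux vx uv.
  by rewrite never_last_obeying ?in_setT.
have extendK : {in domains_with_extremal_paths P Q, cancel restrict extend}.
  move=> D /domains_with_compatible[B cB ->].
  rewrite restrictE // extendE; last exact: pull_represents.
  by apply: obeying_eq => u x v; apply: lift_pull.
rewrite -(card_in_imset (can_in_inj extendK)); congr #|pred_of_set _|.
apply/setP => E; apply/imsetP/idP => [[D] | /domains_sharing_represents[C rC ->]].
  move/domains_with_compatible => [B cB ->] ->; rewrite restrictE //.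
  by apply/domains_sharing_represents; exists (pull B) => //; apply: pull_represents.
have cC := lift_compatible rC.
exists (obeying [set: A] (lift C)); first by apply/domains_with_compatible; exists (lift C).
by rewrite restrictE //; apply: obeying_eq => u x v _ _ _; rewrite pull_lift.
Qed.

End TwinDomains.

Theorem theorem6p4 (m : nat) (A : finType) (s f : A) (a : nat -> A)
    (P : linorder A) (sigma theta : {perm A}) :
  5 <= m ->
  #|A| = m ->
  P = s :: rcons [seq a i | i <- iota 1 (m - 2)] f :> seq A ->
  sigma = tperm (a 1) (a (m - 2)) \/ sigma = tperm (a 2) (a (m - 2)) ->
  theta = (tperm s f * sigma)%g ->
  #|domains_with_extremal_paths P (perm_path theta P)| = calP (m - 3) /\
  (forall D : {set linorder A},
     D \in domains_with_extremal_paths P (perm_path theta P) -> self_paired D).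
Proof.
move=> m5 cA PE sigmaE thetaE.
(* The core has k + 2 = m - 3 elements; a domain on it needs at least two to
   have two terminal elements. *)
have [k mE] : exists k, m = k + 5 by exists (m - 5); lia.
have m3 : m - 3 = k.+2 by lia.
have m2 : m - 2 = k + 3 by lia.
rewrite m2 in PE sigmaE; rewrite m3; rewrite mE in cA.
have [j j12 {}sigmaE] : exists2 j, (j == 1) || (j == 2) & sigma = tperm (a j) (a (k + 3)).
  by case: sigmaE => ->; [exists 1 | exists 2].
have sz : size P = k + 5 by rewrite size_tuple.
have at_nth r x : r < k + 5 -> nth s P r = x -> index x P = r.
  by move=> lr <-; rewrite index_uniq ?lo_uniq ?sz.
have rs : index s P = 0 by rewrite PE /= eqxx.
have rf : index f P = k + 4.
  apply: at_nth; first by rewrite ltn_add2l.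
  have -> : k + 4 = (k + 3).+1 by rewrite addnS.
  by rewrite PE /= nth_rcons size_map size_iota ltnn eqxx.
have ra i : 0 < i < k + 4 -> index (a i) P = i.
  case: i => // i li; apply: at_nth; first by lia.
  rewrite PE /= nth_rcons size_map size_iota.
  have -> : i < k + 3 by lia.
  by rewrite (nth_map 0) ?size_iota ?nth_iota; [rewrite add1n | lia..].
have rj : index (a j) P = j by apply: ra; lia.
have rk : index (a (k + 3)) P = k + 3 by apply: ra; lia.
have theta_rank x : index (theta x) P = rank_swap k j (index x P).
  have inj y : x <> y -> index x P <> index y P by move=> ne /(@index_lo_inj _ P).
  have out y : index y P = 0 \/ index y P = k + 4 -> tperm (a j) (a (k + 3)) y = y.
    by move=> yE; case: tpermP yE => [->|->|//]; rewrite ?rj ?rk; move: j12; lia.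
  rewrite thetaE permM sigmaE; case: (tpermP s f x) => [->|->|/inj xs /inj xf].
  - by rewrite out ?rs ?rf //; right.
  - by rewrite out ?rs ?rf ?rank_swap_top //; left.
  case: tpermP => [->|->|/inj xj /inj xk].
  - by rewrite rj rk rank_swap_j.
  - by rewrite rj rk rank_swap_twin.
  rewrite rs in xs; rewrite rf in xf; rewrite rj in xj; rewrite rk in xk.
  by have [[[]|[]|[]|[]]|[]] := rank_swapE k j (index x P).
split; first exact: (card_twin_domains s j12 cA theta_rank).
by move=> D; apply: (twin_self_paired s j12 cA theta_rank).
Qed.
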